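(* Let $f$ be one of $x^3+3,\ x^3+12,\ x^3+21,\ x^3+3x+3,\ x^3+6x+3,\ x^3+3x^2+3$, let $L$ be its splitting field over $\mathbb{Q}_3$, $E$ a degree $3$ subextension, $F$ the quadratic subextension, and $H=H_1\otimes_{\mathbb{Q}_3}H_2$ the Hopf Galois structure of cyclic type on $L/\mathbb{Q}_3$ induced from $E$ and $F$. Then $\mathcal{O}_L$ is free over $\mathfrak{A}_H$. Moreover, if $f=x^3+3x^2+3$, then for any free generator $\epsilon$ of $\mathcal{O}_E$ over $\mathfrak{A}_{H_1}$ and any free generator $\delta$ of $\mathcal{O}_F$ over $\mathfrak{A}_{H_2}$, the product $\epsilon\delta$ is a free generator of $\mathcal{O}_L$ over $\mathfrak{A}_H$; for the other five polynomials, such a product $\epsilon\delta$ is never a free generator of $\mathcal{O}_L$ over $\mathfrak{A}_H$.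
   Context: $H_1$ is the unique Hopf Galois structure of $E/\mathbb{Q}_3$, $H_2=\mathbb{Q}_3[\mathrm{Gal}(F/\mathbb{Q}_3)]$ the classical structure of $F/\mathbb{Q}_3$, and $H=H_1\otimes H_2$ acts on $L=E\otimes_{\mathbb{Q}_3}F$ by $\langle h_1\otimes h_2,x\otimes y\rangle=\langle h_1,x\rangle\langle h_2,y\rangle$; these are the Hopf Galois structures of cyclic type on $L/\mathbb{Q}_3$. For a Hopf Galois structure $H'$ on $M/\mathbb{Q}_3$, $\mathfrak{A}_{H'}=\{h\in H':h\cdot\mathcal{O}_M\subseteq\mathcal{O}_M\}$, and $\beta$ is a free generator if $h\mapsto h\cdot\beta$ is a bijection $\mathfrak{A}_{H'}\to\mathcal{O}_M$. *)

(* Defs.v *)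
From HB Require Import structures.
From mathcomp Require Import all_boot all_order all_algebra all_fingroup all_field.
Set Implicit Arguments. Unset Strict Implicit. Unset Printing Implicit Defensive.
Import Order.TTheory GRing.Theory Num.Theory.
Local Open Scope ring_scope.

(* K is Q_3 iff K has characteristic 0 and carries an absolute value v
   (with values in Q, as all 3-adic absolute values are powers of 3) that is
   non-archimedean, satisfies v 3 = 1/3, is complete, and Q is dense in K. *)
Definition is_Q3 (K : fieldType) (v : K -> rat) : Prop :=
  [/\ [pchar K] =i pred0,
      ((forall x, 0 <= v x) /\ (forall x, (v x == 0) = (x == 0))),
      ((forall x y, v (x * y) = v x * v y) /\
       (forall x y, v (x + y) <= Num.max (v x) (v y))),
      v 3 = 3^-1
    & ((forall u : nat -> K,
         (forall eps : rat, 0 < eps -> exists N, forall m n, (N <= m)%N -> (N <= n)%N ->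
              v (u m - u n) < eps) ->
         exists l, forall eps : rat, 0 < eps -> exists N, forall n, (N <= n)%N ->
              v (u n - l) < eps) /\
      (forall x (eps : rat), 0 < eps -> exists q : rat, v (x - ratr q) < eps))].

Definition fpoly (K : fieldType) (i : 'I_6) : {poly K} :=
  match val i with
  | 0 => 'X^3 + 3%:P
  | 1 => 'X^3 + 12%:P
  | 2 => 'X^3 + 21%:P
  | 3 => 'X^3 + 3%:P * 'X + 3%:P
  | 4 => 'X^3 + 6%:P * 'X + 3%:P
  | _ => 'X^3 + 3%:P * 'X^2 + 3%:P
  end.

Section HopfData.
Variables (K : fieldType) (v : K -> rat) (L : splittingFieldType K).

Definition OL : L -> Prop := fun x =>
  exists p : {poly K}, [/\ p \is monic, (forall k, v p`_k <= 1)
        & root (map_poly (in_alg L) p) x].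

Definition OM (M : {subfield L}) : L -> Prop := fun x => x \in M /\ OL x.

Variables (E F : {subfield L}).

(* hgs1 : the Hopf Galois structure of E/K (Greither--Pareigis):
   hgs1 = L[N]^G with G = Gal(L/K), N = lambda(C), C = Gal(L/F) the normal
   subgroup of order 3; an element sum_{tau in C} c_tau lambda(tau) is
   encoded by its coefficient function c. *)
Definition hgs1 : pred {ffun gal_of {:L} -> L} := fun c =>
  [&& [forall t, (t \notin 'Gal({:L} / F)%g) ==> (c t == 0)]
    & [forall g, forall t, c (t ^ g)%g == g (c t)]].

Definition hact1 (c : {ffun gal_of {:L} -> L}) (x : L) : L :=
  \sum_(t in 'Gal({:L} / F)%g) c t * (t^-1)%g x.

(* hgs2 = K[Gal(F/K)], elements are coefficient functions *)
Definition hgs2 : pred {ffun gal_of F -> K} := fun a =>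
  [forall g, (g \notin 'Gal(F / 1%AS)%g) ==> (a g == 0)].

Definition hact2 (a : {ffun gal_of F -> K}) (y : L) : L :=
  \sum_(g in 'Gal(F / 1%AS)%g) a g *: g y.

(* H = hgs1 (x) hgs2 acting on L = E (x)_K F (identified via x (x) y |-> x y):
   the K-linear operators on L given by finite sums of pure tensors. *)
Definition hgsH : 'End(L) -> Prop := fun phi =>
  exists s : seq ({ffun gal_of {:L} -> L} * {ffun gal_of F -> K}),
       [/\ all (fun p => hgs1 p.1 && hgs2 p.2) s
         & forall x y, x \in E -> y \in F ->
             phi (x * y) = \sum_(p <- s) hact1 p.1 x * hact2 p.2 y].

Definition hactH (phi : 'End(L)) (x : L) : L := phi x.

End HopfData.

Definition assoc_order (T L : Type) (Hp : T -> Prop) (act : T -> L -> L) (O : L -> Prop)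
  : T -> Prop := fun h => Hp h /\ (forall x, O x -> O (act h x)).

Definition free_gen (T L : Type) (A : T -> Prop) (act : T -> L -> L) (O : L -> Prop) (beta : L)
  : Prop :=
  [/\ forall h, A h -> O (act h beta),
      forall h1 h2, A h1 -> A h2 -> act h1 beta = act h2 beta -> h1 = h2
    & forall y, O y -> exists2 h, A h & act h beta = y].

(* Main.v *)
(* Let a be a root of the depressed cubic x^3 + P x + Q in E, and let D be the product of the
   differences of its conjugates, so that F = Q_3(D). On E, the algebra H_1 acts by a scalar on 1
   and through a two-dimensional commutative algebra on the trace-zero plane. Since 2 is a unit, O_L
   splits under the involution fixing E as O_E + M z, where z is a multiple of D by a power of 3, and
   A_H splits as A(O_E) e+ + A(M) e-, where A(N) is the order of N in H_1. So O_L is A_H-free as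
   soon as O_E and M have generators, which can be written down.
   If F is ramified (z^2 = 3 unit), then M = a^-1 O_E strictly contains O_E, while A(M) preserves
   O_E; hence the odd part of eps delta, an integer, cannot generate M. If F is unramified (the last
   polynomial), then M = O_E and the components of delta are units. *)
Require Import Defs.
From HB Require Import structures.
From mathcomp Require Import all_boot all_order all_algebra all_fingroup all_solvable all_field.
From mathcomp Require Import ring lra.
Import Order.TTheory GRing.Theory Num.Theory.
Local Open Scope ring_scope.

Set Implicit Arguments. Unset Strict Implicit. Unset Printing Implicit Defensive.

(** * The valuation ring of Q_3 *)

(** Integrality in [E] is handled without extending [v]. For an Eisenstein element pi, [Zpi] is
    O[pi] and [Upi] its elements with unit constant term. Any y in [E] lies in O[pi], or some
    pi^(n+1) y lies in [Upi]; a monic equation for y rules out the second case. This gives O_E =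
    O[pi]; applied to 3 y^2 = -(y z)^2 / m it also gives M. The basis 1, a, b with b = a^2 + 2p
    turns orders into divisibility conditions on three coordinates, since the coefficients of H_1 on
    <a, b> depend only on p and Q. The five ramified cubics are x^3 + 3p x + 3q with q a unit and p
    zero or a unit. For p = 0 the vectors a and b are eigenvectors of H_1; for p a unit they are
    mixed with unit coefficients, so the two cases need different generators. The last cubic,
    translated by 1, becomes x^3 - 3x + 5, that is p = -1. The scaling of z comes from D^2 = -27
    (Q^2 + 4 p^3). *)

Section Valuation.
Variables (K : fieldType) (v : K -> rat) (hK : is_Q3 v).

Lemma v_ge0 x : 0 <= v x. Proof. by case: hK => _ [H _] *; apply: H. Qed.
Lemma v_eq0 x : (v x == 0) = (x == 0). Proof. by case: hK => _ [_ H] *; apply: H. Qed.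
Lemma vM x y : v (x * y) = v x * v y. Proof. by case: hK => _ _ [H _] *; apply: H. Qed.
Lemma vD x y : v (x + y) <= Num.max (v x) (v y).
Proof. by case: hK => _ _ [_ H] *; apply: H. Qed.
Lemma v3 : v 3 = 3^-1. Proof. by case: hK. Qed.
Lemma v_dense x eps : 0 < eps -> exists q : rat, v (x - ratr q) < eps.
Proof. by case: hK => _ _ _ _ [_ H]; apply: H. Qed.

Lemma v0 : v 0 = 0. Proof. by apply/eqP; rewrite v_eq0. Qed.

Lemma v1 : v 1 = 1.
Proof.
have h : v 1 != 0 by rewrite v_eq0 oner_eq0.
by apply: (mulfI h); rewrite -vM !mulr1.
Qed.

Lemma vN x : v (- x) = v x.
Proof.
have : v (-1) ^+ 2 = 1 by rewrite expr2 -vM mulrNN mulr1 v1.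
move/eqP; rewrite sqrf_eq1 => /orP[] /eqP h; first by rewrite -mulN1r vM h mul1r.
by have := v_ge0 (-1); rewrite h.
Qed.

Lemma vV x : v x^-1 = (v x)^-1.
Proof.
have [->|x0] := eqVneq x 0; first by rewrite invr0 v0 invr0.
have h : v x != 0 by rewrite v_eq0.
by apply: (mulfI h); rewrite -vM !divff ?v1.
Qed.

Lemma vX x n : v (x ^+ n) = v x ^+ n.
Proof. by elim: n => [|n IH]; rewrite ?expr0 ?v1 // !exprS vM IH. Qed.

Lemma v_eq_of_lt x y : v (x - y) < v x -> v y = v x.
Proof.
move=> h; apply/eqP; rewrite eq_le; apply/andP; split.
  have := vD x (- (x - y)); have -> : x + - (x - y) = y by ring.
  by rewrite vN => /le_trans -> //; rewrite ge_max lexx ltW.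
have := vD (x - y) y; rewrite subrK le_max => /orP[]//.
by move=> h2; have := lt_le_trans h h2; rewrite ltxx.
Qed.

Definition vint : {pred K} := fun x => v x <= 1.

Lemma vint_subring : subring_closed vint.
Proof.
split=> [|x y hx hy|x y hx hy]; rewrite /in_mem /= /vint.
- by rewrite v1.
- by apply: le_trans (vD _ _) _; rewrite vN ge_max; apply/andP.
- by rewrite vM mulr_ile1 // v_ge0.
Qed.
HB.instance Definition _ := GRing.isSubringClosed.Build K vint vint_subring.

Lemma vintE x : (x \in vint) = (v x <= 1). Proof. by []. Qed.

Lemma vint_add x y : x \in vint -> y \in vint -> x + y \in vint.
Proof. by move=> hx hy; apply: rpredD. Qed.
Lemma vint_sub x y : x \in vint -> y \in vint -> x - y \in vint.
Proof. by move=> hx hy; apply: rpredB. Qed.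
Lemma vint_opp x : x \in vint -> - x \in vint.
Proof. by move=> hx; rewrite -sub0r; apply: vint_sub => //; apply: rpred0. Qed.
Lemma vint_mul x y : x \in vint -> y \in vint -> x * y \in vint.
Proof. by move=> hx hy; apply: rpredM. Qed.
Lemma vint_nat n : n%:R \in vint.
Proof. exact: rpred_nat. Qed.
Lemma vint0 : 0 \in vint. Proof. exact: vint_nat 0. Qed.
Lemma vint1 : 1 \in vint. Proof. exact: vint_nat 1. Qed.
Lemma vint_exp x n : x \in vint -> x ^+ n \in vint.
Proof. by move=> hx; apply: rpredX. Qed.

Lemma v_nat_unit n : ~~ (3 %| n)%N -> v n%:R = 1.
Proof.
move=> h; have n0 : (0 < n)%N by case: n h.
have /eqP cop : coprime n 3 by rewrite coprime_sym prime_coprime.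
have [a b e _] := egcdnP 3 n0; rewrite cop in e.
have vle k : v k%:R <= 1 by rewrite -vintE rpred_nat.
have va : v (n%:R * a%:R) = 1.
  have -> : (n%:R * a%:R : K) = 1 + b%:R * 3.
    by rewrite -natrM mulnC e natrD natrM addrC.
  have := @v_eq_of_lt 1 (1 + b%:R * 3).
  have -> : 1 - (1 + b%:R * 3) = - (b%:R * 3) :> K by ring.
  rewrite vN v1 vM v3 => -> //.
  by have := vle b; lra.
apply/le_anti; rewrite vle /=; rewrite -va vM; have := vle a; have := v_ge0 n%:R; nra.
Qed.

(** In lowest terms, a denominator divisible by 3 makes the numerator a unit, and the value is then
    at least 3. *)
Lemma v_rat_discr (q : rat) : v (ratr q) < 3 -> v (ratr q) <= 1.
Proof.
rewrite /ratr vM vV; case: (ratP q) => n d.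
rewrite !pmulrn => cop.
have vle k : v k%:~R <= 1 by rewrite -vintE rpred_int.
have [h|h] := boolP (3 %| d.+1)%N; last first.
  by rewrite -pmulrn (v_nat_unit h) invr1 mulr1 => _; apply: vle.
have -> : v n%:~R = 1.
  have vabs : v n%:~R = v `|n|%N%:R.
    by rewrite -[RHS]/(v (`|n|%N%:~R)); case: (intP n) => // m; rewrite ?abszN ?mulrNz ?vN.
  rewrite vabs; apply: v_nat_unit; apply/negP => h2.
  have := dvdn_gcd 3 `|n| d.+1; rewrite h h2 (eqP cop); by [].
have [m ->] := dvdnP h.
rewrite -pmulrn natrM vM v3 mul1r invfM invrK.
have vm : v m%:R <= 1 by rewrite -vintE rpred_nat.
have [e|n0] := eqVneq (v m%:R) 0; first by rewrite e invr0 mul0r => _; lra.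
have m0 : 0 < v m%:R by rewrite lt_def n0 v_ge0.
have : 1 <= (v m%:R)^-1 by rewrite invf_ge1.
by move=> h1 h2; have: False by lra.
Qed.

(** Density provides a rational of the same value, so discreteness passes from Q to [K]. This turns
    strict bounds into integrality. *)
Lemma v_discr x : v x < 3 -> x \in vint.
Proof.
move=> h; rewrite vintE leNgt; apply/negP => h1.
have [q hq] := @v_dense x 1 isT.
have e := v_eq_of_lt (lt_trans hq h1).
by have := @v_rat_discr q; rewrite e leNgt h1 => /(_ h).
Qed.

Lemma vint_dvd3 x : x \in vint -> v x != 1 -> x / 3 \in vint.
Proof.
rewrite vintE => h n1; apply: v_discr; rewrite vM vV v3 invrK.
have h2 : v x < 1 by rewrite lt_neqAle n1 h.
by lra.
Qed.

Lemma vintV x : v x = 1 -> x^-1 \in vint.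
Proof. by move=> h; rewrite vintE vV h invr1. Qed.

Lemma three_neq0 : 3 != 0 :> K. Proof. by rewrite -v_eq0 v3. Qed.

Lemma nat_neq0 n : (0 < n)%N -> n%:R != 0 :> K.
Proof.
move=> n0; have [/(pcharf0P K) h _ _ _ _] := hK.
by rewrite h -lt0n.
Qed.

(** The valuation ring as a type: the theory of [integralOver], stated for ring morphisms, then
    yields sums, products and transitivity for [OL]. *)
Record vring := VRing {vval : K; _ : vval \in vint}.
HB.instance Definition _ := [isSub for vval].
HB.instance Definition _ := [Choice of vring by <:].
HB.instance Definition _ := [SubChoice_isSubComNzRing of vring by <:].

(** * Integral elements *)

Variable L : splittingFieldType K.
Definition vring_to : vring -> L := in_alg L \o val.
HB.instance Definition _ := GRing.RMorphism.on vring_to.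

Lemma OL_P x : OL v x <-> integralOver vring_to x.
Proof.
split=> [[p [mp cp rp]]|[p mp rp]].
  (* The default 0 of [insubd] is never taken, as all coefficients are integral. *)
  pose q := \poly_(i < size p) (insubd (0 : vring) p`_i).
  have qE i : val q`_i = p`_i.
    rewrite coef_poly; case: ltnP => h; last by rewrite nth_default.
    by rewrite val_insubd vintE cp.
  have sq : size q = size p.
    apply: size_poly_eq; apply/eqP => /(congr1 val).
    rewrite val_insubd vintE cp -lead_coefE (monicP mp).
    by apply/eqP; rewrite oner_eq0.
  exists q.
    rewrite monicE lead_coefE sq; apply/eqP/val_inj.
    by apply: etrans (qE _) _; rewrite -lead_coefE (monicP mp).
  have -> // : map_poly vring_to q = map_poly (in_alg L) p.
  by apply/polyP => i; rewrite !coef_map /vring_to /=; congr (_ *: _); apply: qE.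
exists (map_poly val p); split.
- by apply: monic_map.
- by move=> k; rewrite coef_map -vintE; case: (p`_k).
- by rewrite -map_poly_comp.
Qed.

Lemma OL_sub (x y : L) : OL v x -> OL v y -> OL v (x - y).
Proof. by move=> /OL_P hx /OL_P hy; apply/OL_P/integral_sub. Qed.
Lemma OL_add (x y : L) : OL v x -> OL v y -> OL v (x + y).
Proof. by move=> /OL_P hx /OL_P hy; apply/OL_P/integral_add. Qed.
Lemma OL_mul (x y : L) : OL v x -> OL v y -> OL v (x * y).
Proof. by move=> /OL_P hx /OL_P hy; apply/OL_P/integral_mul. Qed.

Lemma OL_vint c : c \in vint -> OL v (c%:A : L).
Proof. by move=> h; apply/OL_P; apply: (integral_id vring_to (VRing h)). Qed.

Lemma OL1 : OL v (1 : L). Proof. by have := OL_vint (rpred1 vint); rewrite scale1r. Qed.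

Lemma OL_scale c (x : L) : c \in vint -> OL v x -> OL v (c *: x).
Proof. by move=> hc hx; rewrite -[x]mul1r scalerAl; apply: OL_mul => //; apply: OL_vint. Qed.

Lemma OL_monic (p : {poly L}) (x : L) :
  p \is monic -> (forall i, OL v p`_i) -> root p x -> OL v x.
Proof.
move=> mp hp rp; apply/OL_P; apply: (integral_root_monic mp rp).
by apply/integral_poly => i; apply/OL_P.
Qed.

Lemma OL_sqr (x : L) : OL v (x ^+ 2) -> OL v x.
Proof.
move=> h; apply: (@OL_monic ('X^2 - (x ^+ 2)%:P)); first exact: monicXnsubC.
  move=> i; rewrite coefB coefXn coefC; apply: OL_sub.
    by case: eqP => _; [exact: OL1 | have := OL_sub OL1 OL1; rewrite subrr].
  by case: eqP => _ //; have := OL_sub OL1 OL1; rewrite subrr.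
by rewrite /root !hornerE subrr.
Qed.

Lemma OL_rmorph (g : gal_of {:L}) (x : L) : OL v x -> OL v (g x).
Proof.
move=> [p [mp cp /rootP rp]]; exists p; split=> //; apply/rootP.
have -> : map_poly (in_alg L) p = map_poly g (map_poly (in_alg L) p).
  by rewrite -map_poly_comp; apply: eq_map_poly => c /=; rewrite linearZ /= rmorph1.
by rewrite horner_map rp rmorph0.
Qed.

(** The valuation ring is integrally closed: if v c > 1, the leading term of a monic equation
    strictly dominates the sum of the others. *)
Lemma OL_scalar c : OL v (c%:A : L) -> c \in vint.
Proof.
move=> [p [mp cp /rootP]]; rewrite -[c%:A]/(in_alg L c) horner_map /= => /eqP.
rewrite scaler_eq0 oner_eq0 orbF => /eqP h.
rewrite vintE leNgt; apply/negP => h1.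
have c0 : v c != 0 by rewrite gt_eqF // (lt_trans _ h1).
move: h; rewrite horner_coef polySpred ?monic_neq0 //.
rewrite big_ord_recr /= -lead_coefE (monicP mp) mul1r.
set n := (size p).-1 => h.
have sub m : (m <= n)%N -> v (\sum_(i < m) p`_i * c ^+ i) < v (c ^+ n).
  elim: m => [_|m IH hm].
    by rewrite big_ord0 v0 vX exprn_gt0 // (lt_trans _ h1).
  rewrite big_ord_recr /=; apply: le_lt_trans (vD _ _) _.
  rewrite gt_max IH ?(ltnW hm) // vM !vX /=.
  apply: (@le_lt_trans _ _ (v c ^+ m)); last by rewrite ltr_eXn2l.
  by rewrite ler_piMl ?exprn_ge0 ?v_ge0.
have := sub n (leqnn n); move/eqP: h; rewrite addr_eq0 => /eqP ->.
by rewrite vN ltxx.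
Qed.

End Valuation.

(** Numerals unfold to [1 *+ n], the shape caught by the last rule. *)
Ltac vint_tac hK := repeat match goal with
  | H : is_true (in_mem ?x _) |- is_true (in_mem ?x _) => exact H
  | |- is_true (in_mem (_ + _) _) => apply: (vint_add hK)
  | |- is_true (in_mem (- _) _) => apply: (vint_opp hK)
  | |- is_true (in_mem (_ * _) _) => apply: (vint_mul hK)
  | |- is_true (in_mem (_ ^+ _) _) => apply: (vint_exp hK)
  | |- is_true (in_mem 0 _) => exact: (vint0 hK)
  | |- is_true (in_mem 1 _) => exact: (vint1 hK)
  | |- is_true (in_mem (_ *+ _) _) => exact: (vint_nat hK)
  end.

(** * Cubic Eisenstein extensions *)

Section Eisenstein.
Variables (K : fieldType) (v : K -> rat) (hK : is_Q3 v) (L : splittingFieldType K).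
Variables (pi : L) (A B c : K).
Local Notation k := (in_alg L).
Local Notation O := (vint v).
Hypotheses (hA : A \in O) (hB : B \in O) (hc : v c = 1).
Hypothesis hpi : pi ^+ 3 + k (3 * A) * pi ^+ 2 + k (3 * B) * pi + k (3 * c) = 0.
Hypothesis hfree : forall x y z, k x + k y * pi + k z * pi ^+ 2 = 0 ->
  [/\ x = 0, y = 0 & z = 0].

Definition Zpi (x : L) : Prop :=
  exists a b d, [/\ a \in O, b \in O, d \in O & x = k a + k b * pi + k d * pi ^+ 2].

(** The substitute for having valuation zero in [L]. *)
Definition Upi (x : L) : Prop :=
  exists u s, [/\ v u = 1, Zpi s & x = k u + pi * s].

Lemma pi_cube : pi ^+ 3 = - (k (3 * A) * pi ^+ 2 + k (3 * B) * pi + k (3 * c)).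
Proof. by apply/eqP; rewrite -subr_eq0 opprK -hpi !addrA. Qed.

Lemma pi_neq0 : pi != 0.
Proof.
apply/eqP => e; have [] := hfree (x := 0) (y := 1) (z := 0).
  by rewrite e; ring.
by move=> _ /eqP; rewrite oner_eq0.
Qed.

Lemma hcO : c \in O. Proof. by rewrite vintE hc. Qed.

Lemma Zpi_add x y : Zpi x -> Zpi y -> Zpi (x + y).
Proof.
move=> [a [b [d [ha hb hd ->]]]] [a' [b' [d' [ha' hb' hd' ->]]]].
exists (a + a'), (b + b'), (d + d'); split; [vint_tac hK..|ring].
Qed.

Lemma Zpi_scale u x : u \in O -> Zpi x -> Zpi (k u * x).
Proof.
move=> hu [a [b [d [ha hb hd ->]]]].
by exists (u * a), (u * b), (u * d); split; [vint_tac hK..|ring].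
Qed.

Lemma Zpi_opp x : Zpi x -> Zpi (- x).
Proof.
move=> [a [b [d [ha hb hd ->]]]].
by exists (- a), (- b), (- d); split; [vint_tac hK..|ring].
Qed.

Lemma Zpi_const u : u \in O -> Zpi (k u).
Proof. by move=> hu; exists u, 0, 0; split; [vint_tac hK..|ring]. Qed.

Lemma Zpi_mul_pi x : Zpi x -> Zpi (pi * x).
Proof.
have hcO := hcO.
move=> [a [b [d [ha hb hd ->]]]].
exists (- (3 * c * d)), (a - 3 * B * d), (b - 3 * A * d); split; [vint_tac hK..|].
have -> : pi * (k a + k b * pi + k d * pi ^+ 2)
  = k a * pi + k b * pi ^+ 2 + k d * pi ^+ 3 by ring.
rewrite pi_cube; ring.
Qed.

Lemma Zpi_mul x y : Zpi x -> Zpi y -> Zpi (x * y).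
Proof.
move=> hx [a [b [d [ha hb hd ->]]]].
have -> : x * (k a + k b * pi + k d * pi ^+ 2)
  = k a * x + k b * (pi * x) + k d * (pi * (pi * x)) by ring.
by do 2?apply: Zpi_add; apply: Zpi_scale => //; do ?apply: Zpi_mul_pi.
Qed.

Lemma Zpi1 : Zpi 1. Proof. by have := Zpi_const (vint1 hK); rewrite rmorph1. Qed.
Lemma Zpi_pi : Zpi pi. Proof. by have := Zpi_mul_pi Zpi1; rewrite mulr1. Qed.

Lemma Zpi_exp x n : Zpi x -> Zpi (x ^+ n).
Proof.
by move=> h; elim: n => [|n IH]; rewrite ?expr0 ?exprS; [exact: Zpi1|apply: Zpi_mul].
Qed.

Lemma Upi_Zpi x : Upi x -> Zpi x.
Proof.
move=> [u [s [hu hs ->]]]; apply: Zpi_add; last exact: Zpi_mul_pi.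
by apply: Zpi_const; rewrite vintE hu.
Qed.

Lemma Upi_mul x y : Upi x -> Upi y -> Upi (x * y).
Proof.
move=> [u [s [hu hs ->]]] [u' [s' [hu' hs' ->]]].
have O1 a : v a = 1 -> a \in O by rewrite vintE => ->.
exists (u * u'), (k u * s' + k u' * s + pi * (s * s')); split; last by ring.
  by rewrite (vM hK) hu hu' mulr1.
do 2?apply: Zpi_add; do ?apply: Zpi_scale; auto.
by apply/Zpi_mul_pi/Zpi_mul.
Qed.

Lemma Upi_exp x n : Upi x -> Upi (x ^+ n).
Proof.
move=> h; elim: n => [|n IH]; last by rewrite exprS; apply: Upi_mul.
exists 1, 0; split; [exact: (v1 hK)| |by rewrite rmorph1 mulr0 addr0].
by have := Zpi_const (vint0 hK); rewrite rmorph0.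
Qed.

(** By the Eisenstein equation, a multiple of pi in O[pi] has constant coordinate -3cd, of value at
    most 1/3. *)
Lemma Upi_not_dvd x s : Upi x -> Zpi s -> x = pi * s -> False.
Proof.
move=> [u [s' [hu hs' ->]]] hs e.
have hp := pi_cube.
have [a [b [d [ha hb hd e']]]] : Zpi (s - s') by apply: Zpi_add => //; apply: Zpi_opp.
have [] := hfree (x := u + 3 * c * d) (y := 3 * B * d - a) (z := 3 * A * d - b).
  have : k u - pi * (s - s') = 0 by rewrite mulrBr -e; ring.
  have -> : k u - pi * (s - s') = k u - k a * pi - k b * pi ^+ 2 - k d * pi ^+ 3.
    by rewrite e'; ring.
  by move=> <-; rewrite hp; ring.
move=> /eqP; rewrite addr_eq0 => /eqP e2 _ _.
move: hu; rewrite e2 (vN hK) !(vM hK) (v3 hK) hc => h.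
by move: hd; rewrite vintE; lra.
Qed.

(** A constant term that is not a unit equals 3c w with w integral, and the Eisenstein equation
    makes 3c a multiple of pi. *)
Lemma Zpi_cases x : Zpi x -> Upi x \/ exists2 s, Zpi s & x = pi * s.
Proof.
have hcO := hcO.
move=> [a [b [d [ha hb hd ->]]]].
have [e|ne] := eqVneq (v a) 1; [left|right].
  exists a, (k b + k d * pi); split=> //; last by ring.
  by exists b, d, 0; split=> //; [vint_tac hK|ring].
have ha3 := vint_dvd3 hK ha ne.
have hcV := vintV hK hc.
have c0 : c != 0 by rewrite -(v_eq0 hK) hc oner_eq0.
have t0 := three_neq0 hK.
pose w := a / 3 / c.
exists (k (b - 3 * B * w) + k (d - 3 * A * w) * pi + k (- w) * pi ^+ 2).
  by exists (b - 3 * B * w), (d - 3 * A * w), (- w); split=> //; rewrite /w; vint_tac hK.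
have -> : a = 3 * c * w by rewrite /w; field; rewrite c0.
transitivity (k (3 * c * w) + k b * pi + k d * pi ^+ 2 - k w *
  (pi ^+ 3 + k (3 * A) * pi ^+ 2 + k (3 * B) * pi + k (3 * c))).
  by rewrite hpi mulr0 subr0.
by ring.
Qed.

Lemma Zpi_descend N y : Zpi (pi ^+ N * y) -> Zpi y \/ exists n, Upi (pi ^+ n.+1 * y).
Proof.
elim: N => [|N IH]; first by rewrite expr0 mul1r; left.
move=> /Zpi_cases [h|[s hs e]]; [by right; exists N|apply: IH].
have -> // : pi ^+ N * y = s.
by apply: (mulfI pi_neq0); rewrite -e exprS mulrA.
Qed.

Lemma vint_archi (x : K) : exists n, 3 ^+ n * x \in O.
Proof.
have [n hn] : exists n, v x <= 3 ^+ n.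
  have : 0 <= v x by apply: (v_ge0 hK).
  have := @archi_boundP _ (v x); move=> /[apply].
  set m := Num.bound _ => h; exists m; apply/ltW/(lt_trans h).
  rewrite -natrX ltr_nat; exact: ltn_expl.
exists n; rewrite vintE (vM hK) (vX hK) (v3 hK) exprVn mulrC ler_pdivrMr ?mul1r //.
by rewrite exprn_gt0.
Qed.

(** Up to sign, the quotient of pi^3 by 3; it exchanges powers of 3 for powers of pi. *)
Definition three_quot := k c + pi * (k A * pi + k B).

Lemma three_quotE : 3 * three_quot = - pi ^+ 3.
Proof. by rewrite pi_cube /three_quot; ring. Qed.

Lemma three_quot_Zpi : Zpi three_quot.
Proof.
have hcO := hcO.
exists c, B, A; split=> //; rewrite /three_quot; ring.
Qed.

(** A power 3^n clears the denominators of the coordinates; it is exchanged for pi^(3n), whose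
    factors are then stripped one by one. *)
Lemma Zpi_or_Upi a b d : let y := k a + k b * pi + k d * pi ^+ 2 in
  Zpi y \/ exists n, Upi (pi ^+ n.+1 * y).
Proof.
move=> y.
have [[n1 h1] [[n2 h2] [n3 h3]]] := (vint_archi a, (vint_archi b, vint_archi d)).
pose n := (n1 + n2 + n3)%N.
apply: (@Zpi_descend (3 * n)).
have hT m : Zpi ((- three_quot) ^+ m) by apply/Zpi_exp/Zpi_opp/three_quot_Zpi.
have -> : pi ^+ (3 * n) * y = (- three_quot) ^+ n * (k (3 ^+ n * a) + k (3 ^+ n * b) * pi
    + k (3 ^+ n * d) * pi ^+ 2).
  rewrite exprM -[pi ^+ 3]opprK -three_quotE -mulrN exprMn /y.
  by rewrite !rmorphM !rmorphXn !rmorph_nat; ring.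
apply: Zpi_mul => //.
exists (3 ^+ n * a), (3 ^+ n * b), (3 ^+ n * d); split=> //.
- have -> : 3 ^+ n * a = 3 ^+ n2 * 3 ^+ n3 * (3 ^+ n1 * a) by rewrite /n !exprD; ring.
  by vint_tac hK.
- have -> : 3 ^+ n * b = 3 ^+ n1 * 3 ^+ n3 * (3 ^+ n2 * b) by rewrite /n !exprD; ring.
  by vint_tac hK.
- have -> : 3 ^+ n * d = 3 ^+ n1 * 3 ^+ n2 * (3 ^+ n3 * d) by rewrite /n !exprD; ring.
  by vint_tac hK.
Qed.

(** If w = pi^(m+1) y were in [Upi], a monic equation of degree n for y, multiplied by pi^((m+1)n),
    would make w^n a multiple of pi. *)
Lemma OL_Zpi a b d : let y := k a + k b * pi + k d * pi ^+ 2 in OL v y -> Zpi y.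
Proof.
move=> y [p [mp cp /rootP rp]].
have [//|[m hU]] := Zpi_or_Upi a b d; rewrite -/y in hU.
set w := _ * y in hU.
move: rp; rewrite (horner_coef_wide (n := size p)) ?size_map_poly //.
rewrite polySpred ?monic_neq0 //; set n := (size p).-1.
rewrite big_ord_recr /= [X in _ + X * _]coef_map -lead_coefE (monicP mp) /= scale1r mul1r => e.
exfalso.
have [s hs es] : exists2 s, Zpi s &
    pi ^+ (m.+1 * n) * (\sum_(i < n) (map_poly k p)`_i * y ^+ i) = pi * s.
  (* Each term with i < n carries a spare factor pi^((m+1)(n-i)); the predecessor in the exponent
     removes the one pi put in front. *)
  exists (\sum_(i < n) k p`_i * (pi ^+ (m.+1 * (n - i)).-1 * w ^+ i)).
    elim/big_ind: _ => [|? ? ? ?|i _].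
    - by have := Zpi_const (vint0 hK); rewrite rmorph0.
    - exact: Zpi_add.
    - apply: Zpi_scale; first by rewrite vintE.
      apply: Zpi_mul; first exact/Zpi_exp/Zpi_pi.
      exact/Zpi_exp/Upi_Zpi.
  rewrite !mulr_sumr; apply: eq_bigr => i _; have -> : (map_poly k p)`_i = k p`_i by rewrite coef_map.
  have hn : (m.+1 * n = (m.+1 * (n - i)).-1.+1 + m.+1 * i)%N.
    rewrite prednK ?muln_gt0 ?subn_gt0 ?ltn_ord //.
    by rewrite -mulnDr subnK // ltnW.
  rewrite /w exprMn -exprM hn exprD exprS.
  by ring.
apply: (@Upi_not_dvd (w ^+ n) (- s)); [exact: Upi_exp|exact: Zpi_opp|].
rewrite mulrN -es /w exprMn -exprM; apply/eqP; rewrite -addr_eq0 -mulrDr addrC.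
by rewrite e mulr0.
Qed.

Lemma Zpi_OL y : Zpi y -> OL v y.
Proof.
have hcO := hcO.
have hp : OL v pi.
  pose p := [:: k (3 * c); k (3 * B); k (3 * A); 1].
  have pE : Poly p = p :> seq L by apply: (@PolyK _ 0); rewrite /= oner_eq0.
  apply: (@OL_monic _ _ hK _ (Poly p)).
  - by rewrite monicE lead_coefE pE.
  - have O0 : OL v (0 : L) by have := OL_vint hK L (vint0 hK); rewrite scale0r.
    move=> i; rewrite pE; case: i => [|[|[|[|i]]]] /=; last by rewrite nth_nil.
    + by apply: (OL_vint hK); vint_tac hK.
    + by apply: (OL_vint hK); vint_tac hK.
    + by apply: (OL_vint hK); vint_tac hK.
    + exact: (OL1 hK).
  - apply/rootP; rewrite horner_Poly -{}hpi /p /horner_rec; ring.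
move=> [a [b [d [ha hb hd ->]]]].
have h u : u \in O -> OL v (k u) by apply: OL_vint.
apply: (OL_add hK); first apply: (OL_add hK); auto.
  by apply: (OL_mul hK); auto.
by apply: (OL_mul hK); auto; rewrite expr2; apply: (OL_mul hK).
Qed.

(* [3 y^2] integral forces v(y) >= -1/2, hence v(y) >= -1/3, as K(pi) has value group (1/3)Z. *)
Lemma OL_three_sqr a b d : let y := k a + k b * pi + k d * pi ^+ 2 in
  Zpi (3 * y ^+ 2) -> Zpi (pi * y).
Proof.
move=> y h.
have hp := pi_cube.
have e : pi * y = k (- (3 * c * d)) + k (a - 3 * B * d) * pi + k (b - 3 * A * d) * pi ^+ 2.
  have -> : pi * y = k a * pi + k b * pi ^+ 2 + k d * pi ^+ 3 by rewrite /y; ring.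
  by rewrite hp; ring.
have := Zpi_or_Upi (- (3 * c * d)) (a - 3 * B * d) (b - 3 * A * d).
rewrite -e => -[//|[m hU]]; exfalso.
apply: (@Upi_not_dvd _ (- (pi ^+ (2 * m) * (three_quot * (3 * y ^+ 2)))) (Upi_exp 2 hU)).
  apply/Zpi_opp/Zpi_mul; first exact/Zpi_exp/Zpi_pi.
  by apply: Zpi_mul => //; apply: three_quot_Zpi.
have -> : three_quot * (3 * y ^+ 2) = 3 * three_quot * y ^+ 2 by ring.
rewrite three_quotE exprMn -exprM [(m.+1 * 2)%N]mulnC mulnS exprD.
by move: (pi ^+ (2 * m)) => q; ring.
Qed.

End Eisenstein.

(** * The Galois group of a cubic with a quadratic subextension *)

(** The concrete form of S_3 used by all computations: [s] generates Gal(L/F), [t] generates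
    Gal(L/E), and [a] is the root of the depressed cubic in [E]. Through [s3_gen], equivariance can
    be checked on [s] and [t]. *)
Record S3_data (K : fieldType) (L : splittingFieldType K) (P Q : K) (E F : {subfield L})
    (s t : gal_of {:L}) (a : L) : Prop := S3Data {
  s3_root : a ^+ 3 + P%:A * a + Q%:A = 0;
  s3_s3 : forall x, s (s (s x)) = x;
  s3_sV : forall x, (s^-1)%g x = s (s x);
  s3_t2 : forall x, t (t x) = x;
  s3_F : forall x, (x \in F) = (s x == x);
  s3_E : forall x, (x \in E) = (t x == x);
  s3_K : forall x, s x = x -> t x = x -> exists c : K, x = c%:A;
  s3_galF : 'Gal({:L} / F)%g = [set 1; s; s^-1]%g;
  s3_s_neq1 : (s != 1)%g;
  s3_sV_neq1 : (s^-1 != 1)%g;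
  s3_s_neqV : (s != s^-1)%g;
  s3_conj : (s ^ t = s^-1)%g;
  s3_gen : forall g : gal_of {:L}, exists n e,
    [/\ n \in [set 1; s; s^-1]%g, e \in [set 1; t]%g & g = (n * e)%g];
  s3_sa : s a != a;
  s3_ta : t a = a;
  s3_tsa : t (s a) = s (s a)
}.

Section S3.
Variables (K : fieldType) (v : K -> rat) (hK : is_Q3 v) (L : splittingFieldType K).
Variables (P Q : K) (rs : seq L).
Hypotheses (rs_uniq : uniq rs) (rs_size : (size rs <= 3)%N).
Hypothesis rs_root : forall x, (x \in rs) = (x ^+ 3 + P%:A * x + Q%:A == 0).
Hypothesis rs_gen : forall g : gal_of {:L}, {in rs, forall x, g x = x} -> g = 1%g.
Variables (E F : {subfield L}) (hE : \dim E = 3%N) (hF : \dim F = 2%N).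

Lemma galois_full : galois 1 {:L}.
Proof.
apply/and3P; split; [exact: sub1v| |exact: normalFieldf].
apply/separableP => x _; apply: pcharf0_separable.
by move=> p; rewrite (pchar_lalg L); have [h _ _ _ _] := hK; apply: h.
Qed.

Lemma gal_mem_rs (g : gal_of {:L}) x : x \in rs -> g x \in rs.
Proof.
rewrite !rs_root => /eqP h; apply/eqP.
have <- : g (x ^+ 3 + P%:A * x + Q%:A) = g x ^+ 3 + P%:A * g x + Q%:A.
  by rewrite !rmorphD rmorphXn rmorphM /= !linearZ /= rmorph1.
by rewrite h rmorph0.
Qed.

Lemma gal_in1 (g : gal_of {:L}) : g \in 'Gal({:L} / 1%AS)%g.
Proof. by rewrite gal_kHom ?sub1v // k1AHom. Qed.

Lemma gal_inj (g : gal_of {:L}) : injective g.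
Proof. by move=> x y h; apply: (fmorph_inj g). Qed.

Lemma card_gal_le : (#|'Gal({:L} / 1%AS)%g| <= (size rs)`!)%N.
Proof.
rewrite -(size_permutations rs_uniq) cardE.
pose f (g : gal_of {:L}) := [seq g x | x <- rs].
rewrite -(size_map f); apply: uniq_leq_size.
  rewrite map_inj_uniq ?enum_uniq // => g h /eq_in_map e.
  apply/eqP; rewrite eq_mulgV1; apply/eqP/rs_gen => x hx.
  have := galM g (h^-1)%g (memvf x); rewrite e // -galM ?memvf // mulgV gal_id.
  by move=> ->.
move=> _ /mapP [g _ ->]; rewrite mem_permutations.
have u : uniq (f g) by rewrite map_inj_uniq //; apply: gal_inj.
apply: uniq_perm => //.
have sub : {subset f g <= rs} by move=> _ /mapP [x hx ->]; apply: gal_mem_rs.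
by have [] := uniq_min_size u sub _; rewrite ?size_map.
Qed.

(** The degrees of [E] and [F] give divisibility by 6; the permutations of at most three roots give
    the bound 3!. *)
Lemma dim_full : \dim {:L} = 6%N.
Proof.
have hd : (#|'Gal({:L} / 1%AS)%g| = \dim {:L})%N.
  by rewrite -galois_dim ?galois_full // dimv1 divn1.
have h2 : (2 %| \dim {:L})%N by rewrite -hF; apply: field_dimS; apply: subvf.
have h3 : (3 %| \dim {:L})%N by rewrite -hE; apply: field_dimS; apply: subvf.
have h6 : (6 %| \dim {:L})%N by rewrite (@Gauss_dvd 2 3) // h2.
have le6 : (\dim {:L} <= 6)%N.
  rewrite -hd; apply: leq_trans card_gal_le _.
  by case: (size rs) rs_size => [|[|[|[|]]]].
have gt0 : (0 < \dim {:L})%N by rewrite adim_gt0.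
by apply/eqP; rewrite eqn_leq le6 dvdn_leq.
Qed.

Lemma galois_sub (M : {subfield L}) : galois M {:L}.
Proof. by apply: galoisS galois_full; rewrite sub1v subvf. Qed.

Lemma card_galM (M : {subfield L}) : #|'Gal({:L} / M)%g| = (6 %/ \dim M)%N.
Proof. by rewrite -galois_dim ?galois_sub // dim_full. Qed.

Lemma size_rs : size rs = 3%N.
Proof.
have := card_gal_le; rewrite -galois_dim ?galois_full // dimv1 divn1 dim_full.
by case: (size rs) rs_size => [|[|[|[|]]]].
Qed.

Lemma EF_K x : x \in E -> x \in F -> exists c : K, x = c%:A.
Proof.
move=> xE xF.
have d1 : (\dim (E :&: F)%AS %| 3)%N by rewrite -hE field_dimS // capvSl.
have d2 : (\dim (E :&: F)%AS %| 2)%N by rewrite -hF field_dimS // capvSr.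
have d : \dim (E :&: F)%AS = 1%N.
  have := dvdn_gcd (\dim (E :&: F)%AS) 3 2; rewrite d1 d2 /= dvdn1.
  by move/eqP.
have e : (1%AS : {vspace L}) = (E :&: F)%VS.
  by apply/eqP; rewrite eqEdim sub1v dimv1 /=; move: d => /= ->.
have : x \in (1%AS : {vspace L}) by rewrite e memv_cap xE.
by case/vlineP => c ->; exists c.
Qed.

Lemma rs_three x y z : x \in rs -> y \in rs -> z \in rs -> x != y -> x != z -> y != z ->
  rs =i [:: x; y; z].
Proof.
move=> hx hy hz xy xz yz.
have u : uniq [:: x; y; z] by rewrite /= !inE negb_or xy xz yz.
have sub : {subset [:: x; y; z] <= rs} by move=> w; rewrite !inE => /or3P[] /eqP ->.
by have [] := uniq_min_size u sub _; rewrite ?size_rs // => _ h w; rewrite h.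
Qed.

(** An involution permuting three roots fixes one, taken as [a]. An element of order 3 does not fix
    it, so the roots are the [s]-orbit of [a], and [t] exchanges the other two. *)
Lemma S3_exists : exists s t a, S3_data P Q E F s t a.
Proof.
have cE : #|'Gal({:L} / E)%g| = 2%N by rewrite card_galM hE.
have cF : #|'Gal({:L} / F)%g| = 3%N by rewrite card_galM hF.
have [t tE t1] : exists2 t, t \in 'Gal({:L} / E)%g & (t != 1)%g.
  by apply/trivgPn; rewrite -cardG_gt1 cE.
have [s sF s1] : exists2 s, s \in 'Gal({:L} / F)%g & (s != 1)%g.
  by apply/trivgPn; rewrite -cardG_gt1 cF.
have act (g h : gal_of {:L}) x : (g * h)%g x = h (g x) by rewrite galM ?memvf.
have tt : (t * t = 1)%g by apply/eqP; rewrite -[(t * t)%g]/(t ^+ 2)%g -order_dvdn -cE order_dvdG.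
have sss : (s * (s * s) = 1)%g by apply/eqP; rewrite -[(s * (s * s))%g]/(s ^+ 3)%g -order_dvdn -cF order_dvdG.
have t2 x : t (t x) = x by rewrite -act tt gal_id.
have s3 x : s (s (s x)) = x by rewrite -!act sss gal_id.
have sVE : (s^-1 = s * s)%g by apply/eqP; rewrite eq_invg_mul sss.
have sV x : (s^-1)%g x = s (s x) by rewrite sVE act.
have sV1 : (s^-1 != 1)%g by rewrite invg_eq1.
have ssV : (s != s^-1)%g.
  apply/eqP => e; move: sss; rewrite -sVE mulgV => _.
  by move: sVE s1; rewrite -e => /eqP; rewrite -{1}[s]mulg1 => /eqP/mulgI <-; rewrite eqxx.
have galF : 'Gal({:L} / F)%g = [set 1; s; s^-1]%g.
  apply/esym/eqP; rewrite eqEcard cF; apply/andP; split.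
    apply/subsetP => x /setUP[/set2P[]|/set1P] -> //.
    by rewrite groupV.
  by rewrite -setUA cardsU1 cards2 !inE negb_or eq_sym s1 eq_sym sV1 ssV.
have galE : 'Gal({:L} / E)%g = [set 1; t]%g.
  apply/esym/eqP; rewrite eqEcard cE; apply/andP; split.
    by apply/subsetP => x /set2P[] -> //; apply: group1.
  by rewrite cards2 eq_sym t1.
have memE x : (x \in E) = (t x == x).
  rewrite -{1}(galois_fixedField (galois_sub E)).
  apply/idP/idP => [/mem_fixedFieldP[_ /(_ t tE) ->]//|/eqP h].
  by apply/fixedFieldP; rewrite ?memvf // => g; rewrite galE !inE => /orP[] /eqP -> //; rewrite gal_id.
have memF x : (x \in F) = (s x == x).
  rewrite -{1}(galois_fixedField (galois_sub F)).
  apply/idP/idP => [/mem_fixedFieldP[_ /(_ s sF) ->]//|/eqP h].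
  apply/fixedFieldP; rewrite ?memvf // => g; rewrite galF !inE => /orP[/orP[]|] /eqP -> //.
    by rewrite gal_id.
  by rewrite sV !h.
have fix3 (g : gal_of {:L}) x y z : rs =i [:: x; y; z] -> g x = x -> g y = y -> g z = z -> g = 1%g.
  by move=> e gx gy gz; apply: rs_gen => w; rewrite e !inE => /or3P[] /eqP ->.
have [x [y [z er]]] : exists x y z, rs = [:: x; y; z].
  by have := size_rs; case: (rs) => [|x [|y [|z []]]] // _; exists x, y, z.
have e : rs =i [:: x; y; z] by rewrite er.
have [xy xz yz] : [/\ x != y, x != z & y != z].
  by have := rs_uniq; rewrite er /= !inE negb_or => /andP[/andP[? ?] /andP[? _]].
have [a ars ta] : exists2 a, a \in rs & t a = a.
  have hx : x \in rs by rewrite e !inE eqxx.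
  have hy : y \in rs by rewrite e !inE eqxx orbT.
  have hz : z \in rs by rewrite e !inE eqxx !orbT.
  have := gal_mem_rs t hx; have := gal_mem_rs t hy; have := gal_mem_rs t hz.
  rewrite !e !inE => h3 h2 h1.
  case/or3P: h1 => /eqP h1; first by exists x.
    case/or3P: h3 => /eqP h3; last by exists z.
      by move: yz; rewrite -h1 -h3 t2 eqxx.
    by move: xz; rewrite -(t2 x) h1 -(t2 z) h3 eqxx.
  case/or3P: h2 => /eqP h2; last 2 first.
  - by exists y.
  - by move: xy; rewrite -(t2 x) h1 -(t2 y) h2 eqxx.
  by move: yz; rewrite -h1 -h2 t2 eqxx.
(* Otherwise [s] would fix or exchange the two other roots, against s^3 = 1 and s != 1. *)
have sa : s a != a.
  apply/eqP => h.
  have [y' [z' [e' ay az yz']]] : exists y z, [/\ rs =i [:: a; y; z], a != y, a != z & y != z].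
    move: (ars); rewrite e !inE => /or3P[] /eqP ea.
    - by exists y, z; rewrite ea.
    - by exists x, z; rewrite ea eq_sym; split=> // w; rewrite e !inE orbCA.
    - exists x, y; rewrite ea eq_sym xz eq_sym yz xy; split=> // w.
      by rewrite e !inE orbA orbC.
  have hy : y' \in rs by rewrite e' !inE eqxx orbT.
  have hz : z' \in rs by rewrite e' !inE eqxx !orbT.
  have := gal_mem_rs s hz; have := gal_mem_rs s hy; rewrite !e' !inE => hy' hz'.
  have noa w : a != w -> s w != a.
    by apply: contra => /eqP hw; apply/eqP/(gal_inj (g := s)); rewrite h hw.
  rewrite !(negPf (noa _ _)) //= in hy' hz'.
  case/orP: hy' => /eqP hy'.
    case/orP: hz' => /eqP hz'; last by case/eqP: s1; apply: (fix3 _ a y' z').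
    by case/eqP: yz'; apply: (gal_inj (g := s)); rewrite hy' hz'.
  case/orP: hz' => /eqP hz'.
    by case/eqP: yz'; rewrite -(s3 y') hy' hz' hy'.
  by case/eqP: yz'; apply: (gal_inj (g := s)); rewrite hy' hz'.
have ssa : s (s a) != a by apply: contra sa => /eqP h; rewrite -{1}h s3.
have ssa' : s (s a) != s a by apply: contra sa => /eqP/(gal_inj (g := s)) ->.
have e3 : rs =i [:: a; s a; s (s a)].
  by apply: rs_three => //; rewrite ?gal_mem_rs // eq_sym.
have tsa : t (s a) = s (s a).
  have : t (s a) \in rs by rewrite !gal_mem_rs.
  rewrite e3 !inE => /or3P[] /eqP h //.
    by case/eqP: sa; apply: (gal_inj (g := t)); rewrite h ta.
  have : t (s (s a)) \in rs by rewrite !gal_mem_rs.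
  rewrite e3 !inE => /or3P[] /eqP h2.
  - by case/eqP: ssa; apply: (gal_inj (g := t)); rewrite h2 ta.
  - by case/eqP: ssa'; apply: (gal_inj (g := t)); rewrite h2 h.
  - by case/eqP: t1; apply: (fix3 _ a (s a) (s (s a))).
have tssa : t (s (s a)) = s a by rewrite -tsa t2.
exists s, t, a; split=> //.
- by apply/eqP; rewrite -rs_root.
- by move=> x' sx tx; apply: EF_K; rewrite ?memE ?memF ?sx ?tx.
- have tV : (t^-1 = t)%g by apply/eqP; rewrite eq_invg_mul tt.
  apply/eqP; rewrite eq_mulgV1 invgK conjgE tV; apply/eqP.
  by apply: (fix3 _ a (s a) (s (s a))) => //; rewrite !act ?(ta, tsa, tssa, s3).
- move=> g; have : g \in ('Gal({:L} / F) * 'Gal({:L} / E))%g.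
    (* The two subgroups have coprime orders 3 and 2 in a group of order 6. *)
    suff -> : ('Gal({:L} / F) * 'Gal({:L} / E))%g = 'Gal({:L} / 1%AS)%g :> {set _}.
      exact: gal_in1.
    apply/eqP; rewrite eqEcard; apply/andP; split.
      by apply/subsetP => h _; apply: gal_in1.
    by rewrite coprime_cardMg cE cF // -galois_dim ?galois_full // dimv1 dim_full.
  by case/mulsgP => n e' hn he ->; exists n, e'; rewrite -galF -galE.
Qed.

End S3.

(** * The Hopf Galois structures in coordinates *)

Section Action.
Variables (K : fieldType) (v : K -> rat) (hK : is_Q3 v) (L : splittingFieldType K).
Variables (p Q : K) (E F : {subfield L}) (s t : gal_of {:L}) (a : L).
Hypothesis hS : S3_data (3 * p) Q E F s t a.
Hypotheses (hE : \dim E = 3%N).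
Local Notation k := (in_alg L).
Local Notation O := (vint v).

Let natL n : (0 < n)%N -> n%:R != 0 :> L.
Proof. by move=> h; have := nat_neq0 hK h; rewrite -(fmorph_eq0 k) rmorph_nat. Qed.
Let two0 : 2 != 0 :> L. Proof. exact: natL. Qed.
Let three0 : 3 != 0 :> L. Proof. exact: natL. Qed.
Let three0K : 3 != 0 :> K. Proof. exact: (nat_neq0 hK). Qed.
Let two0K : 2 != 0 :> K. Proof. exact: (nat_neq0 hK). Qed.
(** Made for divided differences: y and z are one relation taken at two conjugates, and u is the
    difference of these conjugates. *)
Lemma cancel_diff (u x y z : L) : u != 0 -> y = 0 -> z = 0 -> u * x = y - z -> x = 0.
Proof.
by move=> u0 -> -> /eqP; rewrite subrr mulf_eq0 (negPf u0) => /eqP.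
Qed.

Lemma scale_k u (x : L) : u *: x = k u * x.
Proof. by rewrite mulr_algl. Qed.

Lemma gal_k (M : {vspace L}) (g : gal_of M) u : g (k u) = k u.
Proof. by rewrite /= linearZ /= rmorph1. Qed.

Lemma gal_add (M : {vspace L}) (g : gal_of M) x y : g (x + y) = g x + g y.
Proof. exact: rmorphD. Qed.
Lemma gal_opp (M : {vspace L}) (g : gal_of M) x : g (- x) = - g x.
Proof. exact: rmorphN. Qed.
Lemma gal_mul (M : {vspace L}) (g : gal_of M) x y : g (x * y) = g x * g y.
Proof. exact: rmorphM. Qed.
Lemma gal_exp (M : {vspace L}) (g : gal_of M) x n : g (x ^+ n) = g x ^+ n.
Proof. exact: rmorphXn. Qed.
Lemma gal_inv (M : {vspace L}) (g : gal_of M) x : g x^-1 = (g x)^-1.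
Proof. exact: fmorphV. Qed.
Lemma gal_nat (M : {vspace L}) (g : gal_of M) n : g n%:R = n%:R.
Proof. exact: rmorph_nat. Qed.
Lemma gal_0 (M : {vspace L}) (g : gal_of M) : g 0 = 0.
Proof. exact: rmorph0. Qed.
Lemma gal_inj_eq (M : {vspace L}) (g : gal_of M) x y : (g x == g y) = (x == y).
Proof. exact: (inj_eq (fmorph_inj g)). Qed.
Definition galE := (gal_k, gal_nat, gal_0, gal_add, gal_opp, gal_mul, gal_exp, gal_inv).

Let a1 := s a.
Let a2 := s (s a).
(** The trace of a^2 is -6p, so this shift has trace zero. *)
Let b := a ^+ 2 + k (2 * p).
(* Locked so that [galE] does not distribute automorphisms over it. *)
Definition vdm := locked ((a - s a) * (s a - s (s a)) * (s (s a) - a)).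
Let D := vdm.
Lemma vdmE : D = (a - a1) * (a1 - a2) * (a2 - a).
Proof. by rewrite /D /vdm -lock. Qed.

(** * Symmetric function identities for the three roots *)

Lemma a_cube : a ^+ 3 + k (3 * p) * a + k Q = 0. Proof. exact: s3_root hS. Qed.

Lemma a_quad1 : a ^+ 2 + a * a1 + a1 ^+ 2 + k (3 * p) = 0.
Proof.
have h : a - a1 != 0 by rewrite subr_eq0 eq_sym (s3_sa hS).
have e1 : a1 ^+ 3 + k (3 * p) * a1 + k Q = 0.
  by have := congr1 s a_cube; rewrite !galE.
apply: (cancel_diff h a_cube e1); ring.
Qed.

Lemma a12_neq : a1 != a2.
Proof. by rewrite eq_sym /a2 gal_inj_eq (s3_sa hS). Qed.

Lemma a_sum : a + a1 + a2 = 0.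
Proof.
have h : a1 - a2 != 0 by rewrite subr_eq0 a12_neq.
have e2 : a ^+ 2 + a * a2 + a2 ^+ 2 + k (3 * p) = 0.
  have := congr1 (fun x => s (s x)) a_quad1.
  rewrite !galE (s3_s3 hS) -/a2 => <-.
  by ring.
apply: (cancel_diff h a_quad1 e2); ring.
Qed.

Lemma a2E : a2 = - a - a1.
Proof. by apply/eqP; rewrite -subr_eq0 -a_sum; apply/eqP; ring. Qed.

(** With f the depressed cubic, the product is f'(a) (a1 - a2)^2, where f'(a) = 3a^2 + 3p and (a1 -
    a2)^2 = -3a^2 - 12p. It computes D (s^-1 - s) on [a]. *)
Lemma D_mul_diff : D * (a2 - a1) = k (9 * Q) * a - k (18 * p) * b.
Proof.
have hq := a_quad1; have hc := a_cube.
have -> : k (9 * Q) * a - k (18 * p) * b =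
    k (9 * Q) * a - k (18 * p) * b - 9 * a * (a ^+ 3 + k (3 * p) * a + k Q).
  by rewrite hc; ring.
(* Multiples of the vanishing quadratic relation are inserted, so that [ring] meets an identity in
   independent a and a1. *)
have -> : D * (a2 - a1) =
  (3 * a ^+ 2 + k (3 * p) - (a ^+ 2 + a * a1 + a1 ^+ 2 + k (3 * p))) *
  (- 3 * a ^+ 2 - k (12 * p) + 4 * (a ^+ 2 + a * a1 + a1 ^+ 2 + k (3 * p))).
  by rewrite vdmE a2E; ring.
rewrite hq /b; ring.
Qed.

Lemma D_mul_diff_b : D * (a2 ^+ 2 - a1 ^+ 2) = - (k (9 * Q) * b + k (18 * p ^+ 2) * a).
Proof.
have -> : D * (a2 ^+ 2 - a1 ^+ 2) = - a * (D * (a2 - a1)).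
  by rewrite a2E; ring.
rewrite D_mul_diff /b; have hc := a_cube.
have -> : - (k (9 * Q) * (a ^+ 2 + k (2 * p)) + k (18 * p ^+ 2) * a) =
 - (k (9 * Q) * (a ^+ 2 + k (2 * p)) + k (18 * p ^+ 2) * a) +
   k (18 * p) * (a ^+ 3 + k (3 * p) * a + k Q) by rewrite hc; ring.
ring.
Qed.

(** The discriminant -4P^3 - 27Q^2 at P = 3p, computed as f'(a)^2 (a1 - a2)^2. *)
Lemma D_sqr : D ^+ 2 = k (- 27 * (Q ^+ 2 + 4 * p ^+ 3)).
Proof.
have hq := a_quad1; have hc := a_cube.
have -> : D ^+ 2 =
  (3 * a ^+ 2 + k (3 * p) - (a ^+ 2 + a * a1 + a1 ^+ 2 + k (3 * p))) ^+ 2 *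
  (- 3 * a ^+ 2 - k (12 * p) + 4 * (a ^+ 2 + a * a1 + a1 ^+ 2 + k (3 * p))).
  by rewrite vdmE a2E; ring.
rewrite hq.
have -> : k (- 27 * (Q ^+ 2 + 4 * p ^+ 3)) = k (- 27 * (Q ^+ 2 + 4 * p ^+ 3))
  - 27 * (a ^+ 3 + k (3 * p) * a + k Q) * (a ^+ 3 + k (3 * p) * a - k Q) by rewrite hc; ring.
ring.
Qed.

Lemma t_a1 : t a1 = a2. Proof. exact: s3_tsa hS. Qed.
Lemma t_a2 : t a2 = a1. Proof. by rewrite -t_a1 (s3_t2 hS). Qed.
Lemma s_a : s a = a1. Proof. by []. Qed.
Lemma s_a1 : s a1 = a2. Proof. by []. Qed.
Lemma s_a2 : s a2 = a. Proof. exact: (s3_s3 hS a). Qed.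

Lemma a2_neq : a2 != a.
Proof. by apply: contra (s3_sa hS) => /eqP e; rewrite -{2}s_a2 e. Qed.

Lemma D_neq0 : D != 0.
Proof.
by rewrite vdmE !mulf_neq0 // subr_eq0 ?a12_neq ?a2_neq // eq_sym (s3_sa hS).
Qed.

Lemma s_D : s D = D.
Proof. by rewrite vdmE !galE s_a2 s_a1 s_a; ring. Qed.
Lemma t_D : t D = - D.
Proof. by rewrite vdmE !galE t_a2 t_a1 (s3_ta hS); ring. Qed.

Lemma s_tE y : s y = y -> s (t y) = t y.
Proof.
move=> h; have act (g g' : gal_of {:L}) x : (g * g')%g x = g' (g x) by rewrite galM ?memvf.
have e : (s * t = t * s^-1)%g by rewrite -(s3_conj hS) conjgC conjgE; rewrite mulgA mulgV mul1g.
have := congr1 (fun g : gal_of {:L} => s (g y)) e.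
by rewrite !act (s3_sV hS) (s3_s3 hS) h => ->.
Qed.

(** A polynomial of degree at most 2 over [K] that vanishes at [a] vanishes at three distinct
    conjugates. *)
Lemma root_powers_free x y z : k x + k y * a + k z * a ^+ 2 = 0 -> [/\ x = 0, y = 0 & z = 0].
Proof.
move=> e0.
have e1 : k x + k y * a1 + k z * a1 ^+ 2 = 0.
  by have := congr1 s e0; rewrite !galE.
have e2 : k x + k y * a2 + k z * a2 ^+ 2 = 0.
  by have := congr1 s e1; rewrite !galE.
have f1 : k y + k z * (a + a1) = 0.
  have h : a - a1 != 0 by rewrite subr_eq0 eq_sym (s3_sa hS).
  by apply: (cancel_diff h e0 e1); ring.
have f2 : k y + k z * (a2 + a1) = 0.
  have h : a2 - a1 != 0 by rewrite subr_eq0 eq_sym a12_neq.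
  by apply: (cancel_diff h e2 e1); ring.
have z0 : k z = 0.
  have h : a - a2 != 0 by rewrite subr_eq0 eq_sym a2_neq.
  by apply: (cancel_diff h f1 f2); ring.
have y0 : k y = 0 by move: f1; rewrite z0 mul0r addr0.
have x0 : k x = 0 by move: e0; rewrite z0 y0 !mul0r !addr0.
by split; apply: (fmorph_inj k); rewrite ?x0 ?y0 ?z0 rmorph0.
Qed.

(** * Coordinates on E and on H_1 *)

Definition coE x y z := k x + k y * a + k z * b.

Lemma coE_inE x y z : coE x y z \in E.
Proof.
by rewrite (s3_E hS) /coE /b !galE (s3_ta hS).
Qed.

Lemma coE_inj x y z x' y' z' : coE x y z = coE x' y' z' -> [/\ x = x', y = y' & z = z'].
Proof.
move=> e.
have [] := root_powers_free (x := x - x' + 2 * p * (z - z')) (y := y - y') (z := z - z').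
  transitivity (coE x y z - coE x' y' z'); last by rewrite e subrr.
  by rewrite /coE /b; ring.
move=> h /eqP; rewrite subr_eq0 => /eqP -> /eqP; rewrite subr_eq0 => /eqP ez.
by move: h; rewrite ez subrr mulr0 addr0 => /eqP; rewrite subr_eq0 => /eqP ->.
Qed.

Lemma coE_span x : x \in E -> exists x0 x1 x2, x = coE x0 x1 x2.
Proof.
move=> xE.
have aE : a \in E by rewrite (s3_E hS) (s3_ta hS).
pose X := [tuple 1; a; a ^+ 2].
have fX : free X.
  apply/freeP => c; rewrite !big_ord_recl big_ord0 /= => h.
  have [] := root_powers_free (x := c ord0) (y := c (lift ord0 ord0)) (z := c (lift ord0 (lift ord0 ord0))).
    by rewrite -[RHS]h /= !mulr_algl addr0 addrA.
  move=> h0 h1 h2 [[|[|[|//]]] hi].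
  - by rewrite -h0; congr c; apply: val_inj.
  - by rewrite -h1; congr c; apply: val_inj.
  - by rewrite -h2; congr c; apply: val_inj.
have sE : <<X>>%VS = E.
  apply/eqP; rewrite eqEdim; apply/andP; split.
    apply/span_subvP => y; rewrite !inE => /or3P[] /eqP ->; rewrite ?mem1v ?aE //.
    by rewrite rpredX.
  by rewrite hE; move: fX; rewrite /free => /eqP ->.
move: xE; rewrite -sE => /coord_span; rewrite !big_ord_recl big_ord0 /= => ->.
set c0 := coord _ _ _; set c1 := coord _ _ _; set c2 := coord _ _ _.
exists (c0 - 2 * p * c2), c1, c2.
by rewrite !scale_k /coE /b; ring.
Qed.

(* The element u + (w + q D) lambda(s) + (w - q D) lambda(s^-1); all of L[N]^G has this form. *)
Definition hopf_elt u w q : {ffun gal_of {:L} -> L} :=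
  [ffun g => if g == 1%g then k u else if g == s then k w + k q * D
             else if g == (s^-1)%g then k w - k q * D else 0].

Lemma hact1_sum (c : {ffun gal_of {:L} -> L}) x :
  hact1 F c x = c 1%g * x + c s * s (s x) + c (s^-1)%g * s x.
Proof.
rewrite /hact1 (s3_galF hS) -setUA big_setU1 /=; last first.
  by rewrite !inE negb_or eq_sym (s3_s_neq1 hS) eq_sym (s3_sV_neq1 hS).
rewrite big_setU1 /= ?big_set1 ?inE ?(s3_s_neqV hS) //.
by rewrite invg1 gal_id invgK (s3_sV hS) addrA.
Qed.

Lemma hact1_elt u w q x :
  hact1 F (hopf_elt u w q) x = k u * x + (k w + k q * D) * s (s x) + (k w - k q * D) * s x.
Proof.
rewrite hact1_sum !ffunE eqxx (negPf (s3_s_neq1 hS)) eqxx (negPf (s3_sV_neq1 hS)).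
by rewrite [(s^-1 == s)%g]eq_sym (negPf (s3_s_neqV hS)) eqxx.
Qed.

Lemma conjs_s : (s ^ s = s)%g. Proof. by rewrite conjgE mulKg. Qed.

Lemma conjs_sV : (s ^ s^-1 = s)%g. Proof. by rewrite conjgE mulgV mulg1 invgK. Qed.

(** Equivariance is multiplicative in the automorphism, so [s] and [t] suffice: conjugation by [t]
    exchanges [s] and its inverse while [t] changes the sign of [D]. *)
Lemma hopf_elt_in u w q : hgs1 F (hopf_elt u w q).
Proof.
set c := hopf_elt u w q.
have c1 : c 1%g = k u by rewrite ffunE eqxx.
have cs : c s = k w + k q * D by rewrite ffunE (negPf (s3_s_neq1 hS)) eqxx.
have csV : c (s^-1)%g = k w - k q * D.
  by rewrite ffunE (negPf (s3_sV_neq1 hS)) [(s^-1 == s)%g]eq_sym (negPf (s3_s_neqV hS)) eqxx.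
have c0 g : g \notin [set 1; s; s^-1]%g -> c g = 0.
  by rewrite !inE !negb_or ffunE => /andP[/andP[/negPf -> /negPf ->] /negPf ->].
apply/andP; split.
  by apply/forallP => g; apply/implyP; rewrite (s3_galF hS) => /c0 ->.
have act (g g' : gal_of {:L}) x : (g * g')%g x = g' (g x) by rewrite galM ?memvf.
pose ok (g : gal_of {:L}) := forall n, c (n ^ g)%g = g (c n).
have okM g h : ok g -> ok h -> ok (g * h)%g.
  by move=> hg hh n; rewrite conjgM hh hg act.
have ok1 : ok 1%g by move=> n; rewrite conjg1 gal_id.
have oks : ok s.
  move=> n; have [hn|hn] := boolP (n \in [set 1; s; s^-1]%g).
    have e : (n ^ s = n)%g.
      move: hn => /setUP[/set2P[]|/set1P] ->; [exact: conj1g|exact: conjs_s|].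
      by rewrite conjVg conjs_s.
    rewrite e; move: hn => /setUP[/set2P[]|/set1P] ->.
    - by rewrite c1 gal_k.
    - by rewrite cs !galE s_D.
    - by rewrite csV !galE s_D.
  rewrite (c0 _ hn) gal_0 c0 //; apply: contra hn => /setUP[/set2P[]|/set1P] h.
  - by rewrite -[n](conjgK s) h conj1g !inE eqxx.
  - by rewrite -[n](conjgK s) h conjs_sV !inE eqxx orbT.
  - by rewrite -[n](conjgK s) h conjVg conjs_sV !inE eqxx !orbT.
have okt : ok t.
  have sVt : ((s^-1) ^ t = s)%g by rewrite conjVg (s3_conj hS) invgK.
  move=> n; have [|hn] := boolP (n \in [set 1; s; s^-1]%g).
    move=> /setUP[/set2P[]|/set1P] ->.
    - by rewrite conj1g c1 gal_k.
    - by rewrite (s3_conj hS) cs csV !galE t_D; ring.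
    - by rewrite sVt cs csV !galE t_D; ring.
  rewrite (c0 _ hn) gal_0 c0 //; apply: contra hn => /setUP[/set2P[]|/set1P] h.
  - by rewrite -[n](conjgK t) h conj1g !inE eqxx.
  - by have := conjg_inj t (etrans h (esym sVt)) => ->; rewrite !inE eqxx !orbT.
  - by have := conjg_inj t (etrans h (esym (s3_conj hS))) => ->; rewrite !inE eqxx !orbT.
have oksV : ok (s^-1)%g.
  have -> : (s^-1 = s * s)%g.
    apply/eqP/gal_eqP => x _; rewrite act; exact: s3_sV hS x.
  exact: okM.
apply/forallP => g; apply/forallP => n; apply/eqP.
have [m [e [hm he ->]]] := s3_gen hS g.
have okm : ok m by move: hm => /setUP[/set2P[]|/set1P] ->.
have oke : ok e by move: he => /set2P[] ->.
exact: okM.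
Qed.

(** The coefficient at 1 is fixed by [s] and [t]. Those at [s] and [s^-1] are fixed by [s] and
    exchanged by [t], so their half sum, and their half difference over [D], lie in [K]. *)
Lemma hopf_elt_ex c : hgs1 F c -> exists u w q, c = hopf_elt u w q.
Proof.
move=> /andP[/forallP h0 /forallP hc].
have hg g n : c (n ^ g)%g = g (c n) by apply/eqP; move: (hc g) => /forallP.
have [u hu] := s3_K hS (esym (etrans (congr1 c (esym (conj1g s))) (hg s 1%g)))
  (esym (etrans (congr1 c (esym (conj1g t))) (hg t 1%g))).
have sy : s (c s) = c s by rewrite -hg conjs_s.
have ty : t (c s) = c (s^-1)%g by rewrite -hg (s3_conj hS).
have sy' : s (c (s^-1)%g) = c (s^-1)%g by rewrite -hg conjVg conjs_s.
have ty' : t (c (s^-1)%g) = c s by rewrite -ty (s3_t2 hS).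
have D0 := D_neq0.
have [w hw] : exists w, (c s + c (s^-1)%g) / 2 = k w.
  apply: (s3_K hS); rewrite !galE ?sy ?sy' ?ty ?ty' //.
  by rewrite addrC.
have [q hq] : exists q, (c s - c (s^-1)%g) / (2 * D) = k q.
  apply: (s3_K hS); rewrite !galE ?s_D ?t_D ?sy ?sy' ?ty ?ty' //.
  by field; rewrite ?oppr_eq0 ?D0 ?two0.
exists u, w, q; apply/ffunP => g; rewrite ffunE.
case: eqVneq => [->|g1]; first by rewrite hu.
case: eqVneq => [->|gs]; first by rewrite -hw -hq; field; rewrite ?oppr_eq0 ?D0 ?two0.
case: eqVneq => [->|gsV]; first by rewrite -hw -hq; field; rewrite ?oppr_eq0 ?D0 ?two0.
apply/eqP; apply: (implyP (h0 g)); rewrite (s3_galF hS) !inE !negb_or.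
by rewrite g1 gs gsV.
Qed.

(* [x] is the eigenvalue on 1; on the trace-zero plane <a, b> the action is y + z Y, where
   Y = - D (s^-1 - s) / 9 satisfies Y a = 2 p b - Q a and Y b = 2 p^2 a + Q b. *)
Definition hopf_op x y z := hopf_elt ((x + 2 * y) / 3) ((x - y) / 3) (- z / 9).

Lemma hopf_op_ex c : hgs1 F c -> exists x y z, c = hopf_op x y z.
Proof.
have n9 : 9 != 0 :> K by apply: (nat_neq0 hK).
move=> /hopf_elt_ex [u [w [q ->]]]; exists (u + 2 * w), (u - w), (- 9 * q).
by congr hopf_elt; field.
Qed.

Lemma hact1_op r x y c0 c1 c2 : hact1 F (hopf_op r x y) (coE c0 c1 c2) =
  coE (r * c0) ((x - y * Q) * c1 + 2 * p ^+ 2 * y * c2) (2 * p * y * c1 + (x + y * Q) * c2).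
Proof.
have n9 : 9 != 0 :> L by apply: natL.
rewrite hact1_elt /coE /b !galE -/a1 -/a2.
set u := (r + 2 * x) / 3; set w := (r - x) / 3; set q := - y / 9.
(* The grouping isolates a1 + a2, a1^2 + a2^2 and the two products with [D], each known in terms of
   [a]. *)
transitivity (k (u + 2 * w) * (k c0 + k c2 * k (2 * p)) + (k c1 * (k u * a + k w * (a1 + a2)))
  + k c2 * (k u * a ^+ 2 + k w * (a1 ^+ 2 + a2 ^+ 2)) + k q * k c1 * (D * (a2 - a1))
  + k q * k c2 * (D * (a2 ^+ 2 - a1 ^+ 2))).
  by ring.
rewrite D_mul_diff D_mul_diff_b /b.
have -> : a1 ^+ 2 + a2 ^+ 2 = - a ^+ 2 - k (6 * p) + 2 * (a ^+ 2 + a * a1 + a1 ^+ 2 + k (3 * p)).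
  by rewrite a2E; ring.
have -> : a1 + a2 = - a by rewrite a2E; ring.
rewrite a_quad1.
have -> : r = u + 2 * w by rewrite /u /w; field.
have -> : x = u - w by rewrite /u /w; field.
have -> : y = - 9 * q by rewrite /q; field; apply: (nat_neq0 hK).
by ring.
Qed.

(** * The action of H_2 on F *)

Lemma F_span y : y \in F -> exists y0 y1, y = k y0 + k y1 * D.
Proof.
move=> yF; have D0 := D_neq0.
have sy : s y = y by apply/eqP; rewrite -(s3_F hS).
have sty := s_tE sy.
have [y0 h0] : exists c, (y + t y) / 2 = k c.
  apply: (s3_K hS); rewrite !galE ?sy ?sty ?(s3_t2 hS) //.
  by rewrite addrC.
have [y1 h1] : exists c, (y - t y) / (2 * D) = k c.
  apply: (s3_K hS); rewrite !galE ?s_D ?t_D ?sy ?sty ?(s3_t2 hS) //.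
  by field; rewrite ?oppr_eq0 ?D0 ?two0.
by exists y0, y1; rewrite -h0 -h1; field; rewrite ?oppr_eq0 ?D0 ?two0.
Qed.

Lemma D_inF : D \in F. Proof. by rewrite (s3_F hS) s_D. Qed.
Lemma k_inF x y : k x + k y * D \in F.
Proof. by rewrite (s3_F hS) !galE s_D. Qed.

Lemma galF_D (g : gal_of F) : g D = D \/ g D = - D.
Proof.
have : (g D - D) * (g D + D) = 0.
  by rewrite -subr_sqr -gal_exp D_sqr gal_k subrr.
by move/eqP; rewrite mulf_eq0 subr_eq0 addr_eq0 => /orP[] /eqP; [left|right].
Qed.

(** The two scalars are the values of the trivial and the sign character of the group algebra. *)
Lemma hact2_ex (h : {ffun gal_of F -> K}) : hgs2 h -> exists h0 h1, forall y0 y1,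
  hact2 h (k y0 + k y1 * D) = k (h0 * y0) + k (h1 * y1) * D.
Proof.
move=> _.
pose sg (g : gal_of F) : K := if g D == D then 1 else -1.
exists (\sum_(g in 'Gal(F / 1%AS)%g) h g), (\sum_(g in 'Gal(F / 1%AS)%g) h g * sg g).
move=> y0 y1; rewrite /hact2.
rewrite !mulr_suml !rmorph_sum mulr_suml -big_split; apply: eq_bigr => g _.
have -> : g (k y0 + k y1 * D) = k y0 + k y1 * (k (sg g) * D).
  rewrite !galE /sg; have [->|->] := galF_D g; first by rewrite eqxx rmorph1 mul1r.
  case: eqP => [e|_]; last by rewrite rmorphN1 mulN1r.
  by rewrite rmorph1 mul1r e.
rewrite scale_k; change (k (h g) * (k y0 + k y1 * (k (sg g) * D)) =
  k (h g * y0) + k (h g * sg g * y1) * D).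
ring.
Qed.

(** Realised by h0 (1 + tau)/2 + h1 (1 - tau)/2, a combination of the two idempotents, with tau the
    restriction of [t] to [F]. *)
Lemma hact2_elt h0 h1 : exists2 h : {ffun gal_of F -> K}, hgs2 h & forall y0 y1,
  hact2 h (k y0 + k y1 * D) = k (h0 * y0) + k (h1 * y1) * D.
Proof.
have D0 := D_neq0.
have tF : (t @: F <= F)%VS.
  apply/subvP => _ /memv_imgP [y yF ->]; rewrite (s3_F hS) s_tE //.
  by apply/eqP; rewrite -(s3_F hS).
pose tau := gal F t.
have tauD : tau D = - D by rewrite /tau galK ?D_inF // t_D.
have all_in (g : gal_of F) : g \in 'Gal(F / 1%AS)%g.
  by rewrite gal_kHom ?sub1v // k1AHom.
have tau1 : tau != 1%g.
  apply: contraNneq D0 => e; move: tauD; rewrite e gal_id => /eqP.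
  rewrite -addr_eq0 -mulr2n -mulr_natl mulf_eq0 (negPf two0) /=; by [].
exists [ffun g => if g == 1%g then (h0 + h1) / 2 else if g == tau then (h0 - h1) / 2 else 0].
  by apply/forallP => g; rewrite all_in.
move=> y0 y1; rewrite /hact2 (bigD1 1%g) ?all_in //= (bigD1 tau) ?all_in //=.
rewrite big1 => [|g /andP[/andP[_ /negPf g1] /negPf gt]]; last by rewrite ffunE g1 gt scale0r.
rewrite !ffunE eqxx (negPf tau1) eqxx gal_id !galE tauD addr0.
rewrite !scale_k.
set x := (h0 + h1) / 2; set y := (h0 - h1) / 2.
have e0 : x + y = h0 by rewrite /x /y; field.
have e1 : x - y = h1 by rewrite /x /y; field.
by rewrite -e0 -e1; ring.
Qed.

Lemma hact1_scale (c : {ffun gal_of {:L} -> L}) u x : hact1 F c (k u * x) = k u * hact1 F c x.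
Proof. by rewrite !hact1_sum !galE; ring. Qed.

Lemma hact1_mul_D (c : {ffun gal_of {:L} -> L}) x : hact1 F c (x * D) = hact1 F c x * D.
Proof. by rewrite !hact1_sum !(gal_mul s) !s_D; ring. Qed.

Lemma hact1_add (c : {ffun gal_of {:L} -> L}) x y :
  hact1 F c (x + y) = hact1 F c x + hact1 F c y.
Proof. by rewrite !hact1_sum !galE; ring. Qed.

Lemma hact1_inE c x : hgs1 F c -> x \in E -> hact1 F c x \in E.
Proof.
move=> /hopf_op_ex [r [y [z ->]]] /coE_span [x0 [x1 [x2 ->]]].
by rewrite hact1_op coE_inE.
Qed.

(** * Elements of H as pairs of elements of H_1 *)

Lemma k_inE u : k u \in E.
Proof. by rewrite (s3_E hS) gal_k. Qed.

Lemma split_ex x : exists x0 x1, [/\ x0 \in E, x1 \in E & x = x0 + x1 * D].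
Proof.
have D0 := D_neq0.
exists ((x + t x) / 2), ((x - t x) / (2 * D)); split.
- by rewrite (s3_E hS) !galE (s3_t2 hS) addrC.
- by rewrite (s3_E hS) !galE (s3_t2 hS) t_D; apply/eqP; field; rewrite ?oppr_eq0 ?D0 ?two0.
- by field; rewrite ?D0 ?two0.
Qed.

(* A tensor acts on [x * y] through the two eigenvalues of its second factor. *)
Lemma hgsH_split phi : hgsH E F phi -> exists c c', [/\ hgs1 F c, hgs1 F c' &
  {in E, forall x, phi x = hact1 F c x /\ phi (x * D) = hact1 F c' x * D}].
Proof.
move=> [l [hl hphi]].
suff [c [c' [hc hc' h]]] : exists c c', [/\ hgs1 F c, hgs1 F c' & forall x,
    \sum_(q <- l) hact1 F q.1 x * hact2 q.2 1 = hact1 F c x /\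
    \sum_(q <- l) hact1 F q.1 x * hact2 q.2 D = hact1 F c' x * D].
  exists c, c'; split=> // x xE; have [<- <-] := h x.
  by rewrite -[in LHS](mulr1 x) !hphi ?D_inF ?mem1v.
elim: l hl {hphi} => [_|[c2 h] l IH /= /andP[/andP[hc2 hh] hl]].
  exists (hopf_elt 0 0 0), (hopf_elt 0 0 0); split; try exact: hopf_elt_in.
  by move=> x; rewrite !big_nil hact1_elt rmorph0; split; ring.
have [c [c' [/hopf_elt_ex [u [w [q ->]]] /hopf_elt_ex [u' [w' [q' ->]]] H]]] := IH hl.
have [h0 [h1 hE2]] := hact2_ex hh.
move: hc2 => /hopf_elt_ex [u2 [w2 [q2 ->]]].
exists (hopf_elt (h0 * u2 + u) (h0 * w2 + w) (h0 * q2 + q)),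
  (hopf_elt (h1 * u2 + u') (h1 * w2 + w') (h1 * q2 + q')).
split; try exact: hopf_elt_in.
move=> x; rewrite !big_cons; have [-> ->] := H x.
have e1 : hact2 h 1 = k h0.
  have := hE2 1 0; rewrite rmorph1 rmorph0 mul0r addr0 => ->.
  by rewrite mulr0 mulr1 rmorph0 mul0r addr0.
have e2 : hact2 h D = k h1 * D.
  have := hE2 0 1; rewrite rmorph1 rmorph0 mul1r add0r => ->.
  by rewrite mulr0 mulr1 rmorph0 add0r.
by rewrite e1 e2 !hact1_elt; split; ring.
Qed.

(** The operator is c tensor e+ plus c' tensor e-, where e+ and e- are the idempotents of
    K[Gal(F/K)]; on [L] they project to (x + t x)/2 and (x - t x)/2. *)
Lemma hgsH_build c c' : hgs1 F c -> hgs1 F c' -> exists2 phi, hgsH E F phi &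
  {in E, forall x, phi x = hact1 F c x /\ phi (x * D) = hact1 F c' x * D}.
Proof.
move=> hc hc'.
pose f x := hact1 F c ((x + t x) / 2) + hact1 F c' ((x - t x) / 2).
have n2 : 2 = k 2 by rewrite rmorph_nat.
have f_lin : linear f.
  move=> u x y; rewrite /f !scale_k !galE.
  have -> : (k u * x + y + (k u * t x + t y)) / 2 = k u * ((x + t x) / 2) + (y + t y) / 2.
    by field; rewrite ?two0.
  have -> : (k u * x + y - (k u * t x + t y)) / 2 = k u * ((x - t x) / 2) + (y - t y) / 2.
    by field; rewrite ?two0.
  by rewrite !hact1_add !hact1_scale; ring.
pose fM := GRing.isLinear.Build K L L *:%R f f_lin.
pose fL : {linear L -> L} := HB.pack f fM.
have [ep hep Ep] := hact2_elt 1 0.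
have [em hem Em] := hact2_elt 0 1.
have key x y0 y1 : x \in E ->
    linfun fL (x * (k y0 + k y1 * D)) = hact1 F c x * k y0 + hact1 F c' x * (k y1 * D).
  rewrite (s3_E hS) => /eqP tx; rewrite lfunE -[LHS]/(f _) /f !galE tx t_D.
  have -> : (x * (k y0 + k y1 * D) + x * (k y0 + k y1 * - D)) / 2 = k y0 * x.
    by field; rewrite ?two0.
  have -> : (x * (k y0 + k y1 * D) - x * (k y0 + k y1 * - D)) / 2 = k y1 * (x * D).
    by field; rewrite ?two0.
  by rewrite !hact1_scale hact1_mul_D; ring.
exists (linfun fL).
  exists [:: (c, ep); (c', em)]; split; first by rewrite /= hc hc' hep hem.
  move=> x y xE /F_span [y0 [y1 ->]].
  rewrite key // !big_cons big_nil Ep Em !mul0r !mul1r rmorph0 mul0r addr0 add0r.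
  by rewrite [RHS]addrA [RHS]addr0.
move=> x xE; split.
  by have := key x 1 0 xE; rewrite rmorph1 rmorph0 mul0r addr0 !mulr1 mulr0 addr0 => ->.
have := key x 0 1 xE; rewrite rmorph1 rmorph0 mulr0 !mul1r add0r add0r => ->.
by [].
Qed.

Lemma hact1_id x : hact1 F (hopf_op 1 1 0) x = x.
Proof.
rewrite hact1_elt subrr oppr0 !mul0r !rmorph0.
have -> : (1 + 2 * 1) / 3 = 1 :> K by field.
by rewrite rmorph1; ring.
Qed.

(** * The splitting of integers and orders *)

Variables (zeta : K) (hzeta : zeta != 0).
(* [zeta] is a power of 1/3 making the square of this generator a unit or 3 times a unit. *)
Definition F_gen := locked (k zeta * vdm).
Let z := F_gen.
Lemma zE : z = k zeta * D.
Proof. by rewrite /z /F_gen -lock. Qed.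

Lemma z_neq0 : z != 0.
Proof. by rewrite zE mulf_neq0 ?D_neq0 // fmorph_eq0. Qed.

Lemma t_z : t z = - z.
Proof. by rewrite zE !galE t_D mulrN. Qed.

Lemma kz_inF x y : k x + k y * z \in F.
Proof. by rewrite zE mulrA -rmorphM k_inF. Qed.

Lemma z_sqr : z ^+ 2 = k (- 27 * zeta ^+ 2 * (Q ^+ 2 + 4 * p ^+ 3)).
Proof. by rewrite zE exprMn D_sqr; ring. Qed.

(** The module M, kept inside [E] so that both halves of O_L carry the same action of H_1. *)
Definition minus_part : L -> Prop := fun x => x \in E /\ OL v (x * z).

Local Notation AO := (assoc_order (@hgs1 K L F) (@hact1 K L F) (@OM K v L E)).
Local Notation AM := (assoc_order (@hgs1 K L F) (@hact1 K L F) minus_part).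
Local Notation AH := (assoc_order (@hgsH K L E F) (@hactH K L) (@OL K v L)).

Lemma OL_split x0 x1 : x0 \in E -> x1 \in E -> OL v (x0 + x1 * z) ->
  OL v x0 /\ OL v (x1 * z).
Proof.
rewrite !(s3_E hS) => /eqP h0 /eqP h1 h.
have ht : OL v (x0 - x1 * z).
  by have := OL_rmorph t h; rewrite !(gal_add, gal_mul) t_z h0 h1 mulrN.
have half : (2^-1 : K) \in vint v by apply: (vintV hK); apply: (v_nat_unit hK).
split.
  have -> : x0 = 2^-1 *: ((x0 + x1 * z) + (x0 - x1 * z)).
    by rewrite scale_k fmorphV rmorph_nat; field; rewrite ?two0.
  by apply: (OL_scale hK half); apply: (OL_add hK).
have -> : x1 * z = 2^-1 *: ((x0 + x1 * z) - (x0 - x1 * z)).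
  by rewrite scale_k fmorphV rmorph_nat; field; rewrite ?two0.
by apply: (OL_scale hK half); apply: (OL_sub hK).
Qed.

Lemma split_z x : exists x0 x1, [/\ x0 \in E, x1 \in E & x = x0 + x1 * z].
Proof.
have [x0 [x1 [h0 h1 ->]]] := split_ex x.
exists x0, (x1 / k zeta); split=> //; last first.
  by rewrite zE mulrA divfK // fmorph_eq0.
by rewrite rpredM // -fmorphV k_inE.
Qed.

(** Restricting to O_E and to M z gives one element of each order; together with [AH_build], A_H is
    the product of the two orders. *)
Lemma AH_split phi : AH phi -> exists c c', [/\ AO c, AM c' &
  {in E, forall x, phi x = hact1 F c x /\ phi (x * z) = hact1 F c' x * z}].
Proof.
move=> [/hgsH_split [c [c' [hc hc' h]]] hO].
have h' : {in E, forall x, phi x = hact1 F c x /\ phi (x * z) = hact1 F c' x * z}.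
  move=> x xE; have [-> _] := h x xE; split=> //.
  rewrite {1}zE mulrCA -scale_k linearZ /= scale_k; have [_ ->] := h x xE.
  by rewrite zE; ring.
exists c, c'; split=> //.
  split=> // x [xE xO]; split; first exact: hact1_inE.
  by have [<- _] := h' x xE; apply: hO.
split=> // x [xE xO]; split; first exact: hact1_inE.
by have [_ <-] := h' x xE; apply: hO.
Qed.

Lemma AH_build c c' : AO c -> AM c' -> exists2 phi, AH phi &
  {in E, forall x, phi x = hact1 F c x /\ phi (x * z) = hact1 F c' x * z}.
Proof.
move=> [hc hO] [hc' hM].
have [phi hphi h] := hgsH_build hc hc'.
have h' : {in E, forall x, phi x = hact1 F c x /\ phi (x * z) = hact1 F c' x * z}.
  move=> x xE; have [-> _] := h x xE; split=> //.
  rewrite {1}zE mulrCA -scale_k linearZ /= scale_k; have [_ ->] := h x xE.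
  by rewrite zE; ring.
exists phi => //; split=> // x; have [x0 [x1 [x0E x1E ->]]] := split_z x.
move=> /(OL_split x0E x1E) [h0 h1]; rewrite /hactH linearD /=.
have [-> _] := h' x0 x0E; have [_ ->] := h' x1 x1E.
by apply: (OL_add hK); [case: (hO x0)|case: (hM x1)].
Qed.

Lemma mulz_inj x0 x1 y0 y1 : x0 \in E -> x1 \in E -> y0 \in E -> y1 \in E ->
  x0 + x1 * z = y0 + y1 * z -> x0 = y0 /\ x1 = y1.
Proof.
rewrite !(s3_E hS) => /eqP h0 /eqP h1 /eqP h2 /eqP h3 e.
have et : x0 - x1 * z = y0 - y1 * z.
  by have := congr1 t e; rewrite !(gal_add, gal_mul) t_z h0 h1 h2 h3 !mulrN.
have e0 : x0 = y0.
  by apply: (mulfI two0); have h := congr2 +%R e et; apply: (etrans (etrans _ h)); ring.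
split=> //; apply: (mulIf z_neq0); move: e; rewrite e0; exact: addrI.
Qed.

Lemma AO_id : AO (hopf_op 1 1 0).
Proof. by split=> [|x hx]; [exact: hopf_elt_in | rewrite hact1_id]. Qed.
Lemma AM_id : AM (hopf_op 1 1 0).
Proof. by split=> [|x hx]; [exact: hopf_elt_in | rewrite hact1_id]. Qed.

Lemma free_gen_sum g0 g1 : free_gen AO (@hact1 K L F) (@OM K v L E) g0 ->
  free_gen AM (@hact1 K L F) minus_part g1 ->
  free_gen AH (@hactH K L) (@OL K v L) (g0 + g1 * z).
Proof.
move=> [a0 i0 s0] [a1' i1 s1].
have [g0E g0O] : OM v E g0 by rewrite -[g0]hact1_id; apply/a0/AO_id.
have [g1E g1O] : minus_part g1 by rewrite -[g1]hact1_id; apply/a1'/AM_id.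
split.
- by move=> phi [_ h]; apply: h; apply: (OL_add hK).
- move=> phi psi hphi hpsi.
  have [c [c' [hc hc' h]]] := AH_split hphi.
  have [d [d' [hd hd' h2]]] := AH_split hpsi.
  rewrite /hactH !linearD /=.
  have [-> _] := h g0 g0E; have [_ ->] := h g1 g1E.
  have [-> _] := h2 g0 g0E; have [_ ->] := h2 g1 g1E.
  have [[hc1 _] [hc'1 _]] := (hc, hc'); have [[hd1 _] [hd'1 _]] := (hd, hd').
  move=> /mulz_inj []; try exact: hact1_inE.
  move=> /(i0 _ _ hc hd) ec /(i1 _ _ hc' hd') ec'.
  apply/lfunP => x; have [x0 [x1 [x0E x1E ->]]] := split_z x.
  rewrite !linearD /=.
  have [-> _] := h x0 x0E; have [_ ->] := h x1 x1E.
  have [-> _] := h2 x0 x0E; have [_ ->] := h2 x1 x1E.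
  by rewrite ec ec'.
- move=> y; have [y0 [y1 [y0E y1E ->]]] := split_z y.
  move=> /(OL_split y0E y1E) [h0 h1].
  have [c hc <-] := s0 y0 (conj y0E h0).
  have [c' hc' <-] := s1 y1 (conj y1E h1).
  have [phi hphi h] := AH_build hc hc'.
  exists phi => //; rewrite /hactH linearD /=.
  by have [-> _] := h g0 g0E; have [_ ->] := h g1 g1E.
Qed.

(** Applied to the integer m z, whose even part is zero, surjectivity says that the odd component
    alone generates M. This is the condition that products violate in the ramified case. *)
Lemma free_gen_minus_surj g0 g1 m : g0 \in E -> g1 \in E ->
  free_gen AH (@hactH K L) (@OL K v L) (g0 + g1 * z) ->
  minus_part m -> exists2 c, AM c & hact1 F c g1 = m.
Proof.
move=> g0E g1E [_ _ sH] [mE mO].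
have [phi hphi] := sH _ mO.
have [c [c' [[hc _] hc' h]]] := AH_split hphi.
rewrite /hactH linearD /=; have [-> _] := h g0 g0E; have [_ ->] := h g1 g1E.
rewrite -[m * z]add0r => /mulz_inj [] //; try exact: hact1_inE.
- by case: hc' => ? _; apply: hact1_inE.
- by rewrite rpred0.
by exists c'.
Qed.

Local Notation A2 := (assoc_order (@hgs2 K L F) (@hact2 K L F) (@OM K v L F)).

(** The hypotheses give O_F = O + O z, on whose two lines H_2 acts by independent scalars; a
    generator needs a unit on each line. *)
Lemma free_gen_F delta : OL v z -> (forall d, OL v (k d * z) -> d \in O) ->
  free_gen A2 (@hact2 K L F) (@OM K v L F) delta ->
  exists d0 d1, [/\ delta = k d0 + k d1 * z, v d0 = 1 & v d1 = 1].
Proof.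
move=> zO zd [aF iF sF].
have all_in (g : gal_of F) : g \in 'Gal(F / 1%AS)%g.
  by rewrite gal_kHom ?sub1v // k1AHom.
have [id2 hid Eid] : exists2 h : {ffun gal_of F -> K}, hgs2 h & forall x, hact2 h x = x.
  exists [ffun g => if g == 1%g then 1 else 0].
    by apply/forallP => g; rewrite all_in.
  move=> x; rewrite /hact2 (bigD1 1%g) ?all_in //= big1.
    by rewrite ffunE eqxx scale1r gal_id addr0.
  by move=> g /andP[_ /negPf g1]; rewrite ffunE g1 scale0r.
have [dF dO] : OM v F delta.
  by rewrite -[delta]Eid; apply: aF; split=> // x; rewrite Eid.
have zK y : k y * D = k (y / zeta) * z by rewrite zE mulrA -rmorphM divfK.
have [d0 [d1' ed]] := F_span dF; rewrite zK in ed; set d1 := d1' / zeta in ed.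
(* Reaching 1 + z forces h0 d0 = 1 and h1 d1 = 1, with all four factors integral. *)
have [|h [hh hO] eh] := sF (1 + z).
  split; last by apply: (OL_add hK) => //; apply: (OL1 hK).
  by have := kz_inF 1 1; rewrite rmorph1 mul1r.
have [h0 [h1 Eh]] := hact2_ex hh.
have Ez y0 y1 : hact2 h (k y0 + k y1 * z) = k (h0 * y0) + k (h1 * y1) * z.
  by rewrite zE !mulrA -!rmorphM Eh -mulrA !rmorphM; ring.
have [e0 e1] : h0 * d0 = 1 /\ h1 * d1 = 1.
  have : k (h0 * d0) + k (h1 * d1) * z = k 1 + k 1 * z.
    by rewrite -Ez -ed eh rmorph1 mul1r.
  move=> /mulz_inj []; try exact: k_inE.
  by move=> /(fmorph_inj k) -> /(fmorph_inj k) ->.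
have [d0O d1O] : d0 \in O /\ d1 \in O.
  move: dO; rewrite ed => /(OL_split (k_inE _) (k_inE _)) [/(OL_scalar hK) -> /zd ->].
  by [].
have h0O : h0 \in O.
  have /hO [_] : OM v F 1.
    by split; [rewrite mem1v|exact: (OL1 hK)].
  have := Ez 1 0; rewrite rmorph1 rmorph0 mul0r addr0 => ->.
  by rewrite mulr0 mulr1 rmorph0 mul0r addr0 => /(OL_scalar hK).
have h1O : h1 \in O.
  have /hO [_] : OM v F z.
    by split=> //; have := kz_inF 0 1; rewrite rmorph0 add0r rmorph1 mul1r.
  have := Ez 0 1; rewrite rmorph1 rmorph0 mul1r add0r => ->.
  by rewrite mulr0 mulr1 rmorph0 add0r => /zd.
have unit x y : x \in O -> y \in O -> x * y = 1 -> v y = 1.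
  rewrite !vintE => hx hy /(congr1 v); rewrite (vM hK) (v1 hK) => e.
  by apply/le_anti; rewrite hy -e ler_piMl // (v_ge0 hK).
by exists d0, d1; rewrite (unit h0 d0) // (unit h1 d1).
Qed.

End Action.

(** * Free generators *)

Lemma free_gen_ext (T L : Type) (Hp : T -> Prop) (act : T -> L -> L) (O1 O2 : L -> Prop) g :
  (forall x, O1 x <-> O2 x) ->
  free_gen (assoc_order Hp act O1) act O1 g -> free_gen (assoc_order Hp act O2) act O2 g.
Proof.
move=> e [h1 h2 h3].
have eA h : assoc_order Hp act O2 h -> assoc_order Hp act O1 h.
  by move=> [hH hO]; split=> // x /e /hO /e.
have eA' h : assoc_order Hp act O1 h -> assoc_order Hp act O2 h.
  by move=> [hH hO]; split=> // x /e /hO /e.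
split.
- by move=> h /eA /h1 /e.
- by move=> h h' /eA hh /eA hh'; apply: h2.
- by move=> y /e /h3 [h hh <-]; exists h => //; apply: eA'.
Qed.

Section Generators.
Variables (K : fieldType) (v : K -> rat) (hK : is_Q3 v) (L : splittingFieldType K).
Variables (p Q : K) (E F : {subfield L}) (s t : gal_of {:L}) (a : L).
Hypothesis hS : S3_data (3 * p) Q E F s t a.
Hypotheses (hE : \dim E = 3%N).
Local Notation k := (in_alg L).
Local Notation O := (vint v).
Local Notation co := (coE p a).
Local Notation op := (hopf_op s a).
Local Notation act := (@hact1 K L F).
Local Notation OE := (@OM K v L E).
Local Notation order1 := (assoc_order (@hgs1 K L F) act).

(** Every element of H_1 is an [op r x y], so freeness is a question about three scalars. *)
Lemma free_gen_coord (N : L -> Prop) g : N g ->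
  (forall r x y r' x' y', act (op r x y) g = act (op r' x' y') g ->
     [/\ r = r', x = x' & y = y']) ->
  (forall m, N m -> exists r x y, act (op r x y) g = m /\
     forall n, N n -> N (act (op r x y) n)) ->
  free_gen (order1 N) act N g.
Proof.
move=> Ng inj surj; split.
- by move=> c [_ h]; apply: h.
- move=> c c' [/(hopf_op_ex hK hS) [r [x [y ->]]] _].
  move=> [/(hopf_op_ex hK hS) [r' [x' [y' ->]]] _].
  by move=> /inj [-> -> ->].
- move=> m /surj [r [x [y [<- h]]]]; exists (op r x y) => //.
  by split=> //; apply: hopf_elt_in hS _ _ _.
Qed.

Lemma free_gen_scale g u : v u = 1 ->
  free_gen (order1 OE) act OE g -> free_gen (order1 OE) act OE (k u * g).
Proof.
move=> vu [h1 h2 h3].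
have uO : u \in O by rewrite vintE vu.
have uV : u^-1 \in O by apply: (vintV hK).
have u0 : u != 0 by rewrite -(v_eq0 hK) vu oner_eq0.
have k0 : k u != 0 by rewrite fmorph_eq0.
have sc w x : w \in O -> OE x -> OE (k w * x).
  move=> wO [xE xO]; split; first by rewrite rpredM // (k_inE hS).
  by rewrite -scale_k; apply: (OL_scale hK).
split.
- by move=> c hc; rewrite (hact1_scale hS); apply: sc => //; apply: h1.
- move=> c c' hc hc'; rewrite !(hact1_scale hS) => /(mulfI k0); exact: h2.
- move=> y /(sc _ _ uV) /h3 [c hc e]; exists c => //.
  by rewrite (hact1_scale hS) e mulrA -rmorphM divff // rmorph1 mul1r.
Qed.

Lemma OE_coord x y w : (forall x y w, OL v (co x y w) <-> [/\ x \in O, y \in O & w \in O]) ->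
  OE (co x y w) <-> [/\ x \in O, y \in O & w \in O].
Proof.
move=> h; split=> [[_ /h]//|/h hO]; split=> //; exact: coE_inE hS _ _ _.
Qed.

End Generators.

(** * The ramified case *)

Section Ramified.
Variables (K : fieldType) (v : K -> rat) (hK : is_Q3 v) (L : splittingFieldType K).
Variables (p q : K) (E F : {subfield L}) (s t : gal_of {:L}) (a : L).
Hypothesis hS : S3_data (3 * p) (3 * q) E F s t a.
Hypotheses (hE : \dim E = 3%N).
Variables (zeta m : K).
Local Notation k := (in_alg L).
Local Notation O := (vint v).
Local Notation co := (coE p a).
Local Notation op := (hopf_op s a).
Local Notation act := (@hact1 K L F).
Local Notation OE := (@OM K v L E).
Local Notation order1 := (assoc_order (@hgs1 K L F) act).
Local Notation z := (F_gen s a zeta).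
Local Notation M := (minus_part v E s a zeta).
Hypotheses (hp : p \in O) (hq : v q = 1) (hm : v m = 1) (hzeta : zeta != 0).
Hypothesis hz : z ^+ 2 = k (- (3 * m)).

Let pi_eq : a ^+ 3 + k (3 * 0) * a ^+ 2 + k (3 * p) * a + k (3 * q) = 0.
Proof. by rewrite -[RHS](a_cube hS); ring. Qed.
Let free := root_powers_free hS.
Let O0 : 0 \in O := vint0 hK.
Let qO : q \in O. Proof. by rewrite vintE hq. Qed.
Let mO : m \in O. Proof. by rewrite vintE hm. Qed.
Let qV : q^-1 \in O := vintV hK hq.
Let mV : m^-1 \in O := vintV hK hm.
Let q0 : q != 0. Proof. by rewrite -(v_eq0 hK) hq oner_eq0. Qed.
Let m0 : m != 0. Proof. by rewrite -(v_eq0 hK) hm oner_eq0. Qed.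
Let t0 : 3 != 0 :> K := three_neq0 hK.

Lemma ram_coE_pi x y w : co x y w = k (x + 2 * p * w) + k y * a + k w * a ^+ 2.
Proof. by rewrite /coE; ring. Qed.

Lemma ram_Zpi x y w : Zpi v a (k x + k y * a + k w * a ^+ 2) ->
  [/\ x \in O, y \in O & w \in O].
Proof.
move=> [x' [y' [w' [hx hy hw e]]]].
have [] := free (x := x - x') (y := y - y') (z := w - w').
  transitivity (k x + k y * a + k w * a ^+ 2 - (k x' + k y' * a + k w' * a ^+ 2)).
    by ring.
  by rewrite e subrr.
by do 3!(move=> /eqP; rewrite subr_eq0 => /eqP ->).
Qed.

Lemma ram_OL x y w : OL v (co x y w) <-> [/\ x \in O, y \in O & w \in O].
Proof.
rewrite ram_coE_pi; split.
  move=> /(OL_Zpi hK O0 hp hq pi_eq free) /ram_Zpi [h1 h2 h3]; split=> //.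
  have -> : x = x + 2 * p * w - 2 * p * w by ring.
  by vint_tac hK.
move=> [hx hy hw]; apply: (Zpi_OL hK O0 hp hq pi_eq).
by exists (x + 2 * p * w), y, w; split=> //; vint_tac hK.
Qed.

Lemma ram_OE x y w : OE (co x y w) <-> [/\ x \in O, y \in O & w \in O].
Proof. exact: (OE_coord hS _ _ _ ram_OL). Qed.

Lemma ram_z : OL v z.
Proof. by apply: (OL_sqr hK); rewrite hz; apply: (OL_vint hK); vint_tac hK. Qed.

(** Integrality of the square gives v(d)^2 <= 3, so v(d) < 3, and discreteness concludes. *)
Lemma ram_OL_F d : OL v (k d * z) -> d \in O.
Proof.
move=> h; have := OL_mul hK h h.
have -> : k d * z * (k d * z) = k (- (3 * m) * d ^+ 2).
  by transitivity (k d ^+ 2 * z ^+ 2); [ring|rewrite hz; ring].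
move=> /(OL_scalar hK); rewrite vintE !(vM hK) (vN hK) (vM hK) (v3 hK) hm => h2.
apply: (v_discr hK); rewrite ltNge; apply/negP => h3.
have : 3 * 3 <= v d * v d by rewrite ler_pM.
lra.
Qed.

(** The right-hand side is the condition a n in O[a] on n = [co x y w], since a n = -3q w + (x - p
    w) a + y a^2. *)
Lemma ram_minus x y w : M (co x y w) <-> [/\ x - p * w \in O, y \in O & 3 * w \in O].
Proof.
split.
  move=> [_ h].
  (* Squaring eliminates z and brings the condition back to [E], where the integers are known. *)
  have h3 : OL v (3 * co x y w ^+ 2).
    have -> : 3 * co x y w ^+ 2 = (- m^-1) *: ((co x y w * z) * (co x y w * z)).
      rewrite scale_k; transitivity (k (- m^-1) * z ^+ 2 * co x y w ^+ 2); last by ring.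
      rewrite hz -rmorphM; have -> : - m^-1 * - (3 * m) = 3 by field.
      by rewrite rmorph_nat.
    by apply: (OL_scale hK); [vint_tac hK|apply: (OL_mul hK)].
  have hZ : Zpi v a (3 * co x y w ^+ 2).
    have := coE_span hS hE (x := 3 * co x y w ^+ 2) => -[].
      by rewrite rpredM ?rpredX ?rpred_nat //; apply: (coE_inE hS).
    move=> x' [y' [w' e]]; move: h3; rewrite e ram_coE_pi.
    exact: (OL_Zpi hK O0 hp hq pi_eq free).
  move: hZ; rewrite ram_coE_pi => /(OL_three_sqr hK O0 hp hq pi_eq free).
  have -> : a * (k (x + 2 * p * w) + k y * a + k w * a ^+ 2) =
     k (- (3 * q * w)) + k (x - p * w) * a + k y * a ^+ 2.
    transitivity (k (- (3 * q * w)) + k (x - p * w) * a + k y * a ^+ 2 +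
       k w * (a ^+ 3 + k (3 * 0) * a ^+ 2 + k (3 * p) * a + k (3 * q))); first by ring.
    by rewrite pi_eq mulr0 addr0.
  move=> /ram_Zpi [h1 h2 h4]; split=> //.
  have -> : 3 * w = - (- (3 * q * w)) * q^-1 by field.
  by vint_tac hK.
move=> [h1 h2 h3]; split; first exact: (coE_inE hS).
have ha : OL v a.
  have := (ram_OL 0 1 0).2; rewrite /coE rmorph0 rmorph1 mul1r mul0r addr0 add0r; apply.
  by split=> //; apply: (vint1 hK).
(* The element is -q a^-1 z; its square -3m q^2 a^-2 is integral because a^3 is 3 times an integer
   unit. *)
have hm0 : OL v (k 3^-1 * (a ^+ 2 + k (3 * p)) * z).
  apply: (OL_sqr hK).
  have -> : (k 3^-1 * (a ^+ 2 + k (3 * p)) * z) ^+ 2 =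
     k (- (3 * m * p ^+ 2)) + k (m * q) * a + k (- m * p) * a ^+ 2.
    rewrite exprMn hz exprMn -rmorphXn [3^-1 ^+ 2](_ : _ = (3 * 3)^-1); last by rewrite invfM.
    have -> : (a ^+ 2 + k (3 * p)) ^+ 2 = k 3 * (k p * a ^+ 2 - k q * a + k (3 * p ^+ 2)) +
       a * (a ^+ 3 + k (3 * 0) * a ^+ 2 + k (3 * p) * a + k (3 * q)) by ring.
    rewrite pi_eq mulr0 addr0.
    transitivity (k ((3 * 3)^-1 * 3 * (- (3 * m))) * (k p * a ^+ 2 - k q * a + k (3 * p ^+ 2))).
      by ring.
    have -> : (3 * 3)^-1 * 3 * - (3 * m) = - m by rewrite invfM; field.
    by ring.
  apply: (Zpi_OL hK O0 hp hq pi_eq).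
  by exists (- (3 * m * p ^+ 2)), (m * q), (- m * p); split=> //; vint_tac hK.
have -> : co x y w * z = (x - p * w) *: z + y *: (a * z) +
   (3 * w) *: (k 3^-1 * (a ^+ 2 + k (3 * p)) * z).
  rewrite !scale_k !mulrA -rmorphM [3 * w / 3](_ : _ = w); last by field.
  by rewrite /coE; ring.
apply: (OL_add hK); first apply: (OL_add hK); apply: (OL_scale hK) => //.
  exact: ram_z.
by apply: (OL_mul hK) => //; apply: ram_z.
Qed.

Lemma ram_minus_a : M (co 0 1 0).
Proof. by apply/ram_minus; split; rewrite ?mulr0 ?subr0; vint_tac hK. Qed.

(** This is (a^2 + 3p)/3 = -q a^-1, an element of M outside O_E. *)
Lemma ram_minus_inv : M (co (p / 3) 0 (1 / 3)).
Proof.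
by apply/ram_minus; split=> //; [rewrite mulrA mulr1 subrr|rewrite mulrC divfK //; vint_tac hK].
Qed.

(* As the order of the odd part preserves O_E, its orbit of an integer never leaves O_E,
   whereas the odd part is a^-1 O_E. *)
Lemma ram_not_free eps delta : p = 0 \/ v p = 1 ->
  free_gen (order1 OE) act OE eps ->
  free_gen (assoc_order (@hgs2 K L F) (@hact2 K L F) (@OM K v L F))
    (@hact2 K L F) (@OM K v L F) delta ->
  ~ free_gen (assoc_order (@hgsH K L E F) (@hactH K L) (@OL K v L))
    (@hactH K L) (@OL K v L) (eps * delta).
Proof.
move=> hp0 [h1 _ _] /(free_gen_F hK hS hzeta ram_z ram_OL_F) [d0 [d1 [-> hd0 hd1]]].
have [epsE epsO] : OE eps.
  by rewrite -[eps](hact1_id hK hS); apply: h1; split=> [|x]; rewrite ?(hact1_id hK hS) //;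
    apply: hopf_elt_in hS _ _ _.
have -> : eps * (k d0 + k d1 * z) = k d0 * eps + k d1 * eps * z by ring.
move=> hfree.
have d1O : d1 \in O by rewrite vintE hd1.
have gE : k d1 * eps \in E by rewrite rpredM // (k_inE hS).
have [|c [hc cM] e] := free_gen_minus_surj hK hS hE hzeta _ gE hfree ram_minus_inv.
  by rewrite rpredM // (k_inE hS).
have [r [x [y ec]]] := hopf_op_ex hK hS hc.
have [b0 [b1 [b2 eb]]] := coE_span hS hE gE.
have : OL v (k d1 * eps) by rewrite -scale_k; apply: (OL_scale hK).
rewrite eb => /ram_OL [b0O b1O b2O].
move: e; rewrite eb ec (hact1_op hK hS) => /(coE_inj hS) [_ _ e3].
have := cM _ ram_minus_a; rewrite ec (hact1_op hK hS) => /ram_minus [i1 _ _].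
have := cM _ ram_minus_inv; rewrite ec (hact1_op hK hS) => /ram_minus [_ _ i2].
(* Stability of M, tested on [a] and on -q a^-1, bounds both coefficients that produce the
   b-coordinate of an image. *)
have y1 : 2 * p * y \in O.
  case: hp0 => [->|hp1]; first by rewrite mulr0 mul0r.
  have p0 : p != 0 by rewrite -(v_eq0 hK) hp1 oner_eq0.
  have -> : 2 * p * y = - p^-1 * (r * 0 - p * (2 * p * y * 1 + (x + y * (3 * q)) * 0)) by field.
  have pV := vintV hK hp1.
  by vint_tac hK.
have y2 : x + y * (3 * q) \in O.
  have -> : x + y * (3 * q) = 3 * (2 * p * y * 0 + (x + y * (3 * q)) * (1 / 3)) by field.
  by [].
(* An integer is thus sent to an element with integral b-coordinate, whereas the target -q a^-1 has
   b-coordinate 1/3. *)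
have : 1 / 3 \in O by rewrite -e3; vint_tac hK.
by rewrite vintE mul1r (vV hK) (v3 hK) invrK lern1.
Qed.

(* Here p = 0: the order acts by independent scalars on 1, a and b. *)
Lemma ram_free_split : p = 0 -> exists beta,
  free_gen (assoc_order (@hgsH K L E F) (@hactH K L) (@OL K v L))
    (@hactH K L) (@OL K v L) beta.
Proof.
move=> p0; have two0 : 2 != 0 :> K by apply: (nat_neq0 hK).
have h2 : v 2 = 1 by apply: (v_nat_unit hK).
have h2V : 2^-1 \in O := vintV hK h2.
have O1 := vint1 hK.
(* Each half is the sum of an eigenbasis: 1, a, b for O_E and 1, a, b/3 for M. *)
exists (co 1 1 1 + co 1 1 (1 / 3) * z).
have inj c2 r x y r' x' y' : c2 != 0 ->
    act (op r x y) (co 1 1 c2) = act (op r' x' y') (co 1 1 c2) ->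
    [/\ r = r', x = x' & y = y'].
  move=> c0; rewrite !(hact1_op hK hS) => /(coE_inj hS) [e1 e2 e3].
  rewrite p0 in e2 e3.
  have f2 : x - y * (3 * q) = x' - y' * (3 * q) by apply: (etrans (etrans _ e2)); ring.
  have f3 : x + y * (3 * q) = x' + y' * (3 * q).
    by apply: (mulIf c0); apply: (etrans (etrans _ e3)); ring.
  have ex : x = x'.
    by apply: (mulfI two0); apply: (etrans (etrans _ (congr2 +%R f2 f3))); ring.
  split=> //; first by move: e1; rewrite !mulr1.
  have q3 : 3 * q != 0 by rewrite mulf_neq0.
  by apply: (mulIf q3); move: f3; rewrite ex; apply: addrI.
apply: (free_gen_sum hK hS hE hzeta).
- apply: (free_gen_coord hK hS).
  + by apply/ram_OE.
  + by move=> r x y r' x' y'; apply: inj; apply: oner_neq0.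
  + move=> n [nE nO]; have [u1 [u2 [u3 e]]] := coE_span hS hE nE.
    move: nO; rewrite {n nE}e => /ram_OL [h1 h2' h3].
    (* The eigenvalues x - 3qy on [a] and x + 3qy on [b] become u2 and u3. The scalar y may fail to
       be integral; stability only involves the eigenvalues. *)
    exists u1, ((u2 + u3) / 2), ((u3 - u2) / (2 * (3 * q))).
    have e1 : (u2 + u3) / 2 - (u3 - u2) / (2 * (3 * q)) * (3 * q) = u2.
      by field; rewrite ?q0 ?t0 ?two0.
    have e2 : (u2 + u3) / 2 + (u3 - u2) / (2 * (3 * q)) * (3 * q) = u3 by field; rewrite ?q0 ?t0 ?two0.
    split; first by rewrite (hact1_op hK hS) e1 e2 p0; congr coE; ring.
    move=> n [nE nO]; have [c0 [c1 [c2 e]]] := coE_span hS hE nE.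
    move: nO; rewrite {n nE}e => /ram_OL [i1 i2 i3].
    rewrite (hact1_op hK hS) e1 e2; apply/ram_OE; rewrite p0 expr0n !mulr0 !mul0r !add0r addr0.
    by split; vint_tac hK.
- apply: (free_gen_coord hK hS).
  + apply/ram_minus; rewrite p0 mul0r subr0; split=> //.
    by rewrite mulrC divfK.
  + by move=> r x y r' x' y'; apply: inj; rewrite mulf_neq0 ?invr_eq0 ?oner_eq0.
  + move=> n [nE nO]; have [u1 [u2 [u3 e]]] := coE_span hS hE nE.
    have: M n by split.
    rewrite {n nE nO}e => /ram_minus [h1 h2' h3]; rewrite p0 mul0r subr0 in h1.
    (* The eigenvalue on [b] is now 3 u3, as the generator has b-coordinate 1/3. *)
    exists u1, ((u2 + 3 * u3) / 2), ((3 * u3 - u2) / (2 * (3 * q))).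
    have e1 : (u2 + 3 * u3) / 2 - (3 * u3 - u2) / (2 * (3 * q)) * (3 * q) = u2.
      by field; rewrite ?q0 ?t0 ?two0.
    have e2 : (u2 + 3 * u3) / 2 + (3 * u3 - u2) / (2 * (3 * q)) * (3 * q) = 3 * u3.
      by field; rewrite ?q0 ?t0 ?two0.
    split; first by rewrite (hact1_op hK hS) e1 e2 p0; congr coE; field; rewrite ?q0 ?t0 ?two0.
    move=> n [nE nO]; have [c0 [c1 [c2 e]]] := coE_span hS hE nE.
    have: M n by split.
    rewrite {n nE nO}e => /ram_minus [i1 i2 i3]; rewrite p0 mul0r subr0 in i1.
    rewrite (hact1_op hK hS) e1 e2; apply/ram_minus.
    rewrite p0 expr0n !mulr0 !mul0r !add0r addr0 subr0; split; [vint_tac hK..|].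
    by rewrite mulrCA; vint_tac hK.
Qed.

(** Now Y a = 2p b - 3q a has a unit coefficient at [b], so 1 + a generates O_E. For M the single
    element -q a^-1 suffices. *)
Lemma ram_free_unit : v p = 1 -> exists beta,
  free_gen (assoc_order (@hgsH K L E F) (@hactH K L) (@OL K v L))
    (@hactH K L) (@OL K v L) beta.
Proof.
move=> hp1; have two0 : 2 != 0 :> K by apply: (nat_neq0 hK).
have h2 : v 2 = 1 by apply: (v_nat_unit hK).
have h2V : 2^-1 \in O := vintV hK h2.
have pV : p^-1 \in O := vintV hK hp1.
have p0 : p != 0 by rewrite -(v_eq0 hK) hp1 oner_eq0.
have O1 := vint1 hK.
exists (co 1 1 0 + co (p / 3) 0 (1 / 3) * z).
apply: (free_gen_sum hK hS hE hzeta).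
- apply: (free_gen_coord hK hS).
  + by apply/ram_OE; split.
  + move=> r x y r' x' y'; rewrite !(hact1_op hK hS) => /(coE_inj hS) [e1 e2 e3].
    have ey : y = y'.
      have c0 : 2 * p != 0 by rewrite mulf_neq0.
      by apply: (mulfI c0); apply: (etrans (etrans _ e3)); ring.
    split=> //; first by move: e1; rewrite !mulr1.
    by apply: (addIr (- y * (3 * q))); apply: (etrans (etrans _ e2)); rewrite ?ey; ring.
  + move=> n [nE nO]; have [u1 [u2 [u3 e]]] := coE_span hS hE nE.
    move: nO; rewrite {n nE}e => /ram_OL [h1 h2' h3].
    exists u1, (u2 + u3 / (2 * p) * (3 * q)), (u3 / (2 * p)).
    split; first by rewrite (hact1_op hK hS); congr coE; field; rewrite ?p0 ?q0 ?t0 ?two0.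
    move=> n [nE nO]; have [c0 [c1 [c2 e]]] := coE_span hS hE nE.
    move: nO; rewrite {n nE}e => /ram_OL [i1 i2 i3].
    rewrite (hact1_op hK hS); apply/ram_OE; rewrite invfM; split; vint_tac hK.
- apply: (free_gen_coord hK hS).
  + exact: ram_minus_inv.
  + move=> r x y r' x' y'; rewrite !(hact1_op hK hS) => /(coE_inj hS) [e1 e2 e3].
    have p30 : p / 3 != 0 by rewrite mulf_neq0 ?invr_eq0.
    have ey : y = y'.
      have c0 : 2 * p ^+ 2 / 3 != 0 by rewrite !mulf_neq0 ?invr_eq0 ?expf_neq0.
      by apply: (mulfI c0); apply: (etrans (etrans _ e2)); ring.
    split=> //; first exact: (mulIf p30).
    have c0 : 1 / 3 != 0 :> K by rewrite mulf_neq0 ?invr_eq0 ?oner_eq0.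
    apply: (addIr (y * (3 * q))); apply: (mulIf c0).
    by apply: (etrans (etrans _ e3)); rewrite ?ey; ring.
  + move=> n [nE nO]; have [u1 [u2 [u3 e]]] := coE_span hS hE nE.
    have: M n by split.
    rewrite {n nE nO}e => /ram_minus [h1 h2' h3].
    (* Solutions of 2p^2 y/3 = u2, (x + 3qy)/3 = u3 and r p/3 = u1. The value r = 3 u1/p is
       expressed through u1 - p u3 and 3 u3, the quantities known to be integral. *)
    pose y := 3 * (u2 / (2 * p ^+ 2)); pose x := 3 * u3 - y * (3 * q).
    pose r := 3 * (u1 - p * u3) / p + 3 * u3.
    have yO : y \in O.
      by rewrite /y invfM -exprVn; vint_tac hK.
    exists r, x, y; split.
      by rewrite (hact1_op hK hS) /x /y /r; congr coE; field; rewrite ?p0 ?q0 ?t0 ?two0.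
    move=> n [nE nO]; have [c0 [c1 [c2 e]]] := coE_span hS hE nE.
    have: M n by split.
    rewrite {n nE nO}e => /ram_minus [i1 i2 i3].
    rewrite (hact1_op hK hS); apply/ram_minus; split.
    (* Only 3 c2 is known to be integral: r and x + 3qy = 3 u3 differ by 3 (u1 - p u3)/p, which
       supplies the factor 3. *)
    * have -> : r * c0 - p * (2 * p * y * c1 + (x + y * (3 * q)) * c2) =
        r * (c0 - p * c2) + (u1 - p * u3) * (3 * c2) - 2 * p ^+ 2 * y * c1.
        by rewrite /r /x; field.
      by rewrite /r; vint_tac hK.
    * have -> : (x - y * (3 * q)) * c1 + 2 * p ^+ 2 * y * c2 =
        (x - y * (3 * q)) * c1 + u2 * (3 * c2) by rewrite /y; field; rewrite ?p0 ?two0.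
      by rewrite /x; vint_tac hK.
    * have -> : 3 * (2 * p * y * c1 + (x + y * (3 * q)) * c2) =
        3 * (2 * p * y * c1) + (x + y * (3 * q)) * (3 * c2) by ring.
      by rewrite /x; vint_tac hK.
Qed.

End Ramified.

(** * The case x^3 + 3x^2 + 3, where F is unramified *)

Section Unramified.
Variables (K : fieldType) (v : K -> rat) (hK : is_Q3 v) (L : splittingFieldType K).
Variables (E F : {subfield L}) (s t : gal_of {:L}) (a : L).
Hypothesis hS : S3_data (3 * -1) 5 E F s t a.
Hypotheses (hE : \dim E = 3%N).
Variables (zeta : K).
Local Notation k := (in_alg L).
Local Notation O := (vint v).
Local Notation co := (coE (-1) a).
Local Notation op := (hopf_op s a).
Local Notation act := (@hact1 K L F).
Local Notation OE := (@OM K v L E).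
Local Notation order1 := (assoc_order (@hgs1 K L F) act).
Local Notation z := (F_gen s a zeta).
Local Notation M := (minus_part v E s a zeta).
Local Notation orderH := (assoc_order (@hgsH K L E F) (@hactH K L) (@OL K v L)).
Hypotheses (hzeta : zeta != 0).
Hypothesis hz : z ^+ 2 = k (- 7).

(** The root of x^3 + 3x^2 + 3 itself: the depressed cubic x^3 - 3x + 5 is not Eisenstein. *)
Local Notation pi := (a - 1).

Let pi_eq : pi ^+ 3 + k (3 * 1) * pi ^+ 2 + k (3 * 0) * pi + k (3 * 1) = 0.
Proof. by rewrite -[RHS](a_cube hS); ring. Qed.

Let pi_free x y w : k x + k y * pi + k w * pi ^+ 2 = 0 -> [/\ x = 0, y = 0 & w = 0].
Proof.
move=> e; have [] := root_powers_free hS (x := x - y + w) (y := y - 2 * w) (z := w).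
  by rewrite -[RHS]e; ring.
move=> h1 /eqP; rewrite subr_eq0 => /eqP h2 h3.
by move: h1; rewrite h2 h3 mulr0 subr0 addr0.
Qed.

Let O0 : 0 \in O := vint0 hK.
Let O1 : 1 \in O := vint1 hK.
Let V1 : v 1 = 1 := v1 hK.

(** The change of basis is unimodular, as a = pi + 1 and b = pi^2 + 2 pi - 1. *)
Lemma unr_OL x y w : OL v (co x y w) <-> [/\ x \in O, y \in O & w \in O].
Proof.
have -> : co x y w = k (x + y - w) + k (y + 2 * w) * pi + k w * pi ^+ 2.
  by rewrite /coE; ring.
split.
  move=> /(OL_Zpi hK O1 O0 V1 pi_eq pi_free) [x' [y' [w' [hx hy hw e]]]].
  have [] := pi_free (x := x + y - w - x') (y := y + 2 * w - y') (w := w - w').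
    transitivity (k (x + y - w) + k (y + 2 * w) * pi + k w * pi ^+ 2 -
      (k x' + k y' * pi + k w' * pi ^+ 2)); first by ring.
    by rewrite e subrr.
  move=> /eqP; rewrite subr_eq0 => /eqP e1 /eqP; rewrite subr_eq0 => /eqP e2.
  move=> /eqP; rewrite subr_eq0 => /eqP e3; rewrite -e1 in hx; rewrite -e2 in hy; rewrite -e3 in hw.
  have yO : y \in O by rewrite [y](_ : _ = y + 2 * w - 2 * w); [vint_tac hK|ring].
  split=> //; rewrite [x](_ : _ = x + y - w - y + w); [vint_tac hK|ring].
move=> [hx hy hw]; apply: (Zpi_OL hK O1 O0 V1 pi_eq).
by exists (x + y - w), (y + 2 * w), w; split=> //; vint_tac hK.
Qed.

Lemma unr_OE x y w : OE (co x y w) <-> [/\ x \in O, y \in O & w \in O].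
Proof. exact: (OE_coord hS _ _ _ unr_OL). Qed.

Lemma unr_z : OL v z.
Proof. by apply: (OL_sqr hK); rewrite hz; apply: (OL_vint hK); vint_tac hK. Qed.

Lemma unr_OL_F x : OL v (x * z) -> OL v x.
Proof.
move=> h; have := OL_mul hK h h.
have n7 : 7 != 0 :> K by apply: (nat_neq0 hK).
have n7L : 7 != 0 :> L by have := fmorph_eq0 k 7; rewrite rmorph_nat (negPf n7) => ->.
have V7 : 7^-1 \in O by apply: (vintV hK); apply: (v_nat_unit hK).
have -> : x * z * (x * z) = k (- 7) * x ^+ 2 by rewrite -hz; ring.
move=> h2; apply: (OL_sqr hK).
have -> : x ^+ 2 = (- 7^-1) *: (k (- 7) * x ^+ 2).
  rewrite scale_k mulrA -rmorphM [- 7^-1 * - 7](_ : _ = 1); last by field.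
  by rewrite rmorph1 mul1r.
by apply: (OL_scale hK) => //; vint_tac hK.
Qed.

Lemma unr_minus x : OE x <-> M x.
Proof.
split=> [[xE xO]|[xE xO]]; split=> //; last exact: unr_OL_F.
by apply: (OL_mul hK) => //; apply: unr_z.
Qed.

(** At p = -1 the element Y a = -2b - 5a has a unit coefficient at [b], so 1 + a generates. *)
Lemma unr_free_E : free_gen (order1 OE) act OE (co 1 1 0).
Proof.
have two0 : 2 != 0 :> K by apply: (nat_neq0 hK).
have h2V : 2^-1 \in O by apply: (vintV hK); apply: (v_nat_unit hK).
apply: (free_gen_coord hK hS).
- by apply/unr_OE; split.
- move=> r x y r' x' y'; rewrite !(hact1_op hK hS) => /(coE_inj hS) [e1 e2 e3].
  have ey : y = y'.
    by apply: (mulfI two0); apply: oppr_inj; apply: (etrans (etrans _ e3)); ring.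
  split=> //; first by move: e1; rewrite !mulr1.
  by apply: (addIr (- y * 5)); apply: (etrans (etrans _ e2)); rewrite ?ey; ring.
- move=> n [nE nO]; have [u1 [u2 [u3 e]]] := coE_span hS hE nE.
  move: nO; rewrite {n nE}e => /unr_OL [h1 h2' h3].
  exists u1, (u2 - u3 / 2 * 5), (- (u3 / 2)).
  split; first by rewrite (hact1_op hK hS); congr coE; field; rewrite ?two0.
  move=> n [nE nO]; have [c0 [c1 [c2 e]]] := coE_span hS hE nE.
  move: nO; rewrite {n nE}e => /unr_OL [i1 i2 i3].
  by rewrite (hact1_op hK hS); apply/unr_OE; split; vint_tac hK.
Qed.

Lemma unr_free : exists beta, free_gen orderH (@hactH K L) (@OL K v L) beta.
Proof.
exists (co 1 1 0 + co 1 1 0 * z); apply: (free_gen_sum hK hS hE hzeta).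
  exact: unr_free_E.
exact: free_gen_ext unr_minus unr_free_E.
Qed.

(** Both components of the product, d0 eps and d1 eps, are unit multiples of a generator of O_E =
    M. *)
Lemma unr_free_prod eps delta : free_gen (order1 OE) act OE eps ->
  free_gen (assoc_order (@hgs2 K L F) (@hact2 K L F) (@OM K v L F))
    (@hact2 K L F) (@OM K v L F) delta ->
  free_gen orderH (@hactH K L) (@OL K v L) (eps * delta).
Proof.
move=> heps.
have hd d : OL v (k d * z) -> d \in O by move=> /unr_OL_F /(OL_scalar hK).
move=> /(free_gen_F hK hS hzeta unr_z hd) [d0 [d1 [-> hd0 hd1]]].
have -> : eps * (k d0 + k d1 * z) = k d0 * eps + k d1 * eps * z by ring.
apply: (free_gen_sum hK hS hE hzeta); first exact: (free_gen_scale hK hS).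
by apply: (free_gen_ext unr_minus); apply: (free_gen_scale hK hS).
Qed.

End Unramified.

(** * The six polynomials *)

Section Splitting.
Variables (K : fieldType) (v : K -> rat) (hK : is_Q3 v) (L : splittingFieldType K).
Variables (E F : {subfield L}) (hE : \dim E = 3%N) (hF : \dim F = 2%N).

(** The translation by [c] depresses the cubic. Repetitions among the roots are discarded here; the
    degree count shows that three remain. *)
Lemma cubic_S3 (f : {poly K}) (c P Q : K) : size f = 4%N ->
  (forall x : L, (map_poly (in_alg L) f).[x] =
     (x + c%:A) ^+ 3 + P%:A * (x + c%:A) + Q%:A) ->
  splittingFieldFor 1%AS (map_poly (in_alg L) f) fullv ->
  exists s t a, S3_data P Q E F s t a.
Proof.
move=> sf hf [rs ers hrs].
have in_rs x : (x \in rs) = ((x + c%:A) ^+ 3 + P%:A * (x + c%:A) + Q%:A == 0).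
  by rewrite -hf -[_ == 0]/(root _ _) (eqp_root ers) root_prod_XsubC.
pose rs' := undup [seq x + c%:A | x <- rs].
have mem' x : (x \in rs') = (x - c%:A \in rs).
  rewrite mem_undup; apply/mapP/idP => [[y hy ->]|h]; first by rewrite addrK.
  by exists (x - c%:A); rewrite ?subrK.
apply: (@S3_exists K v hK L P Q rs').
- exact: undup_uniq.
- apply: leq_trans (size_undup _) _; rewrite size_map.
  by have := eqp_size ers; rewrite size_map_poly sf size_prod_XsubC => -[<-].
- by move=> x; rewrite mem' in_rs subrK.
- move=> g hg; apply/eqP/gal_eqP => x _; rewrite gal_id.
  (* The roots generate [L], so the fixed field of an automorphism fixing them is all of [L]. *)
  have /Fadjoin_seqP sub : (1 <= fixedField [set g])%VS /\ {subset rs <= fixedField [set g]}.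
    split; first exact: sub1v.
    move=> y hy; apply/fixedFieldP; rewrite ?memvf // => _ /set1P ->.
    have := hg (y + c%:A); rewrite mem' addrK hy gal_add [g c%:A](gal_k g c) => /(_ isT).
    exact: addIr.
  have /mem_fixedFieldP [_ ->] // : x \in fixedField [set g].
    by apply: (subvP sub); rewrite hrs memvf.
  by rewrite inE.
- exact: hE.
- exact: hF.
Qed.

End Splitting.

Lemma cubic_horner (K : fieldType) (L : splittingFieldType K) (c2 c1 c0 : K) (x : L) :
  (map_poly (in_alg L) ((('X + c2%:P) * 'X + c1%:P) * 'X + c0%:P)).[x] =
  x ^+ 3 + in_alg L c2 * x ^+ 2 + in_alg L c1 * x + in_alg L c0.
Proof.
transitivity (((x + in_alg L c2) * x + in_alg L c1) * x + in_alg L c0); last by ring.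
by rewrite !(rmorphD, rmorphM) /= !map_polyC map_polyX !hornerE.
Qed.

Lemma cubic_size (K : fieldType) (c2 c1 c0 : K) :
  size ((('X + c2%:P) * 'X + c1%:P) * 'X + c0%:P) = 4%N.
Proof.
have h : 'X + c2%:P != 0 by rewrite -size_poly_gt0 size_XaddC.
rewrite size_MXaddC (negPf (_ : _ * 'X + _ != 0)) /= ?size_MXaddC ?(negPf h) ?size_XaddC //.
by rewrite -size_poly_gt0 size_MXaddC (negPf h).
Qed.

Section Main.
Variables (K : fieldType) (v : K -> rat) (hK : is_Q3 v) (L : splittingFieldType K).
Variables (E F : {subfield L}) (hE : \dim E = 3%N) (hF : \dim F = 2%N).
Variables (f : {poly K}).
Hypothesis hL : splittingFieldFor 1%AS (map_poly (in_alg L) f) fullv.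
Local Notation AH := (assoc_order (@hgsH K L E F) (@hactH K L) (@OL K v L)).
Local Notation AH1 := (assoc_order (@hgs1 K L F) (@hact1 K L F) (@OM K v L E)).
Local Notation AH2 := (assoc_order (@hgs2 K L F) (@hact2 K L F) (@OM K v L F)).

(** The equation on [m] says z^2 = -3m with m a unit, the ramified shape of [F]. *)
Lemma ramified_cubic (p q zeta m : K) :
  f = (('X + 0%:P) * 'X + (3 * p)%:P) * 'X + (3 * q)%:P ->
  p \in vint v -> p = 0 \/ v p = 1 -> v q = 1 -> v m = 1 -> zeta != 0 ->
  27 * zeta ^+ 2 * ((3 * q) ^+ 2 + 4 * p ^+ 3) = 3 * m ->
  (exists beta, free_gen AH (@hactH K L) (@OL K v L) beta) /\
  (forall eps delta, free_gen AH1 (@hact1 K L F) (@OM K v L E) eps ->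
       free_gen AH2 (@hact2 K L F) (@OM K v L F) delta ->
       ~ free_gen AH (@hactH K L) (@OL K v L) (eps * delta)).
Proof.
move=> ef pO hp hq hm hzeta em.
have [||s [t [a hS]]] := @cubic_S3 K v hK L E F hE hF f 0 (3 * p) (3 * q) _ _ hL.
- by rewrite ef cubic_size.
- move=> x; rewrite ef cubic_horner.
  change (x ^+ 3 + in_alg L 0 * x ^+ 2 + in_alg L (3 * p) * x + in_alg L (3 * q) =
   (x + in_alg L 0) ^+ 3 + in_alg L (3 * p) * (x + in_alg L 0) + in_alg L (3 * q)).
  ring.
have hz : F_gen s a zeta ^+ 2 = in_alg L (- (3 * m)).
  by rewrite (z_sqr hS) -em; congr (in_alg L _); ring.
split; last first.
  by move=> eps delta; apply: (ram_not_free hK hS hE pO hq hm hzeta hz hp).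
case: hp => [p0|p1].
  exact: (ram_free_split hK hS hE pO hq hm hzeta hz p0).
exact: (ram_free_unit hK hS hE pO hq hm hzeta hz p1).
Qed.

Lemma unramified_cubic : f = (('X + 3%:P) * 'X + 0%:P) * 'X + 3%:P ->
  (exists beta, free_gen AH (@hactH K L) (@OL K v L) beta) /\
  (forall eps delta, free_gen AH1 (@hact1 K L F) (@OM K v L E) eps ->
       free_gen AH2 (@hact2 K L F) (@OM K v L F) delta ->
       free_gen AH (@hactH K L) (@OL K v L) (eps * delta)).
Proof.
move=> ef.
have [||s [t [a hS]]] := @cubic_S3 K v hK L E F hE hF f 1 (3 * -1) 5 _ _ hL.
- by rewrite ef cubic_size.
- move=> x; rewrite ef cubic_horner.
  change (x ^+ 3 + in_alg L 3 * x ^+ 2 + in_alg L 0 * x + in_alg L 3 =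
   (x + in_alg L 1) ^+ 3 + in_alg L (3 * -1) * (x + in_alg L 1) + in_alg L 5).
  ring.
have n9 : 9 != 0 :> K by apply: (nat_neq0 hK).
have n3 := three_neq0 hK.
(* Here p = -1 and Q = 5, so D^2 = -27 * 21 = -81 * 7, and D/9 has square -7. *)
have hzeta : 9^-1 != 0 :> K by rewrite invr_eq0.
have hz : F_gen s a 9^-1 ^+ 2 = in_alg L (- 7).
  by rewrite (z_sqr hS); congr (in_alg L _); field; rewrite ?n9 ?n3.
split; first exact: (unr_free hK hS hE hzeta hz).
by move=> eps delta; apply: (unr_free_prod hK hS hE hzeta hz).
Qed.

End Main.

Unset Implicit Arguments.

Theorem mainTheorem12 (i : 'I_6) (K : fieldType) (v : K -> rat) (hK : is_Q3 v)
  (L : splittingFieldType K)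
  (hL : splittingFieldFor 1%AS (map_poly (in_alg L) (fpoly K i)) fullv)
  (E F : {subfield L}) (hE : \dim E = 3%N) (hF : \dim F = 2%N) :
  let AH := assoc_order (@hgsH K L E F) (@hactH K L) (@OL K v L) in
  let AH1 := assoc_order (@hgs1 K L F) (@hact1 K L F) (@OM K v L E) in
  let AH2 := assoc_order (@hgs2 K L F) (@hact2 K L F) (@OM K v L F) in
  (exists beta, free_gen AH (@hactH K L) (@OL K v L) beta) /\
  (if val i == 5%N then
     forall eps delta, free_gen AH1 (@hact1 K L F) (@OM K v L E) eps ->
       free_gen AH2 (@hact2 K L F) (@OM K v L F) delta ->
       free_gen AH (@hactH K L) (@OL K v L) (eps * delta)
   else
     forall eps delta, free_gen AH1 (@hact1 K L F) (@OM K v L E) eps ->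
       free_gen AH2 (@hact2 K L F) (@OM K v L F) delta ->
       ~ free_gen AH (@hactH K L) (@OL K v L) (eps * delta)).
Proof.
move=> AH AH1 AH2.
have n9 : 9 != 0 :> K by apply: (nat_neq0 hK).
have n3 := three_neq0 hK.
have i9 : 9^-1 != 0 :> K by rewrite invr_eq0.
have i3 : 3^-1 != 0 :> K by rewrite invr_eq0.
have vn n : ~~ (3 %| n)%N -> v n%:R = 1 by apply: (v_nat_unit hK).
have O0 := vint0 hK; have O1 := vint1 hK; have O2 := vint_nat hK 2.
have v0 := v1 hK.
have pure (q : K) : v q = 1 -> fpoly K i = 'X^3 + (3 * q)%:P ->
  (exists beta, free_gen AH (@hactH K L) (@OL K v L) beta) /\
  (forall eps delta, free_gen AH1 (@hact1 K L F) (@OM K v L E) eps ->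
       free_gen AH2 (@hact2 K L F) (@OM K v L F) delta ->
       ~ free_gen AH (@hactH K L) (@OL K v L) (eps * delta)).
  move=> hq ef.
  (* At p = 0 the equation on [m] reads 27 * 9 q^2 / 81 = 3 q^2. *)
  apply: (ramified_cubic hK hE hF hL (p := 0) (q := q) (zeta := 9^-1) (m := q ^+ 2)) => //.
  - by rewrite ef mulr0 polyC0 !addr0 exprSr expr2.
  - by left.
  - by rewrite (vX hK) hq expr1n.
  - by field; rewrite ?n9 ?n3.
case: i hL pure => [[|[|[|[|[|[|//]]]]]] hi] hL pure /=.
- by apply: (pure 1) => //; rewrite /fpoly /= mulr1.
- by apply: (pure 4%:R) => //; [apply: vn|rewrite /fpoly /= -natrM].
- by apply: (pure 7%:R) => //; [apply: vn|rewrite /fpoly /= -natrM].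
(* With zeta = 1/3 and q = 1, m is 9 + 4p^3: 13 at p = 1, and 41 at p = 2 below. *)
- apply: (ramified_cubic hK hE hF hL (p := 1) (q := 1) (zeta := 3^-1) (m := 13%:R)) => //.
  + by rewrite /fpoly /= !mulr1 polyC0 addr0 mulrDl exprSr expr2.
  + by right.
  + exact: vn.
  + by field; rewrite ?n9 ?n3.
- apply: (ramified_cubic hK hE hF hL (p := 2) (q := 1) (zeta := 3^-1) (m := 41%:R)) => //.
  + by rewrite /fpoly /= mulr1 -natrM polyC0 addr0 mulrDl exprSr expr2.
  + by right; apply: vn.
  + exact: vn.
  + by field; rewrite ?n9 ?n3.
- apply: (unramified_cubic hK hE hF hL).
  by rewrite /fpoly /= polyC0 addr0 !mulrDl exprSr expr2 mulrA.
Qed.
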